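(* Let $R$ be a ring with $\mathbb{Z} \subseteq R \subseteq \mathbb{Q}$, let $n \geq 3$ be an integer and let $d>0$ be a divisor of $n$. Then $R[L_d]^{S_n}$ is a polynomial ring over $R$ if and only if $\frac{d}{n} \in R$, except in the case $n=4$ and $d=2$, where $\mathbb{Z}[L_2]^{S_4}$ is also a polynomial ring over $\mathbb{Z}$. (That is: the equivalence holds for all $(n,d) \neq (4,2)$, and for $(n,d)=(4,2)$ the ring $\mathbb{Z}[L_2]^{S_4}$ is a polynomial ring over $\mathbb{Z}$ although $\frac{2}{4}\notin\mathbb{Z}$.)
   Context: Let $n\ge 3$ and let $d>0$ be a divisor of $n$. Let $E^{i,j}$ be the $(n-1)\times(n-1)$-matrix whose $(i,j)$-th entry is $1$ and all of whose other entries are $0$; by convention $E^{0,j}$ and $E^{n,j}$ denote the zero matrix. For $1 \le k \le n-1$ put $$F_k = I_{n-1}+E^{n-k-1,n-k}-2E^{n-k,n-k}+E^{n-k+1,n-k},$$ where $I_{n-1}$ is the identity matrix, and put $$V_d = d\,E^{1,1}+\sum_{i=2}^{n-1}\left(E^{i,i}+(n-i)E^{1,i}\right)\in \mathrm{GL}_{n-1}(\mathbb{Q}).$$ It is a theorem of Craig that mapping the transposition $(k,k+1)$ to $V_d^{-1}F_kV_d$ for $1\le k\le n-1$ defines a representation $S_n\to \mathrm{GL}_{n-1}(\mathbb{Z})$. The free $\mathbb{Z}$-module $\mathbb{Z}^{n-1}$ (of column vectors) with this action of $S_n$ is denoted $L_d$. For a ring $R$ with $\mathbb{Z}\subseteq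 R\subseteq\mathbb{Q}$, $R[L_d]$ denotes the polynomial ring $R[x_1,\dots,x_{n-1}]$, viewed as polynomial functions on $L_d\otimes_{\mathbb{Z}} R=R^{n-1}$ ($x_i$ being the $i$-th coordinate function), with $S_n$ acting by $(\sigma f)(v)=f(\sigma^{-1}v)$; that is, $S_n$ acts by the corresponding linear substitutions of the variables. $R[L_d]^{S_n}$ is the subring of invariants. ''Is a polynomial ring'' means: is isomorphic, as an $R$-algebra, to a polynomial ring over $R$ in finitely many variables. *)

(* Defs.v *)
From HB Require Import structures.
From mathcomp Require Import all_boot all_order all_algebra all_fingroup.
From mathcomp Require Import mxrepresentation.
From mathcomp Require Import mpoly.
From mathcomp Require Import zify ring.

Set Implicit Arguments.
Unset Strict Implicit.
Unset Printing Implicit Defensive.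

Import GRing.Theory Num.Theory.

Local Open Scope ring_scope.

(* Indices i, j are 1-based; an index outside 1 .. n - 1 gives 0, so
   E^{0,j} = E^{n,j} = 0 as required in [craigF]. *)
Definition craigE (n i j : nat) : 'M[rat]_n.-1 :=
  \matrix_(a, b) ((a.+1 == i) && (b.+1 == j))%:R.

Definition craigF (n k : nat) : 'M[rat]_n.-1 :=
  1%:M + craigE n (n - k - 1) (n - k)
       - 2%:R *: craigE n (n - k) (n - k)
       + craigE n (n - k + 1) (n - k).

Definition craigV (n d : nat) : 'M[rat]_n.-1 :=
  d%:R *: craigE n 1 1
  + \sum_(2 <= i < n) (craigE n i i + (n - i)%:R *: craigE n 1 i).

(* [L] is the action of S_n on the column lattice L_d. The 1-based
   transposition (k, k+1) is [tperm i j] with i = k - 1 and j = k in 'I_n.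
   [mx_representation] is a morphism for the product of 'S_n, so v |-> L s *m v
   is a left action of that group on columns. *)
Definition is_craig_rep (n d : nat)
    (L : mx_representation int [set: 'S_n] n.-1) : Prop :=
  forall (k : nat) (i j : 'I_n), i.+1 = k -> j = k :> nat ->
    map_mx intr (L (tperm i j)) = invmx (craigV n d) *m craigF n k *m craigV n d.

Section Invariants.

Variables (R : comNzRingType) (n m : nat).
Variable L : mx_representation int [set: 'S_n] m.

(* (s f)(v) = f (s^-1 v): the variable x_i is replaced by the i-th coordinate
   of L(s^-1) x. *)
Definition poly_act (s : 'S_n) (f : {mpoly R[m]}) : {mpoly R[m]} :=
  f \mPo [tuple \sum_(j < m) (L s^-1%g i j)%:~R *: 'X_j | i < m].

HB.instance Definition _ (s : 'S_n) :=
  GRing.RMorphism.copy (poly_act s) (comp_mpoly _).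
HB.instance Definition _ (s : 'S_n) :=
  GRing.Linear.copy (poly_act s) (comp_mpoly _).

Definition invariant_pred : pred {mpoly R[m]} :=
  fun f => [forall s : 'S_n, poly_act s f == f].

Lemma invariant_subalg : subalg_closed invariant_pred.
Proof.
split=> [|a f g /forallP hf /forallP hg|f g /forallP hf /forallP hg];
  apply/forallP=> s.
- by rewrite rmorph1.
- by rewrite linearP /= (eqP (hf s)) (eqP (hg s)).
- by rewrite rmorphM /= (eqP (hf s)) (eqP (hg s)).
Qed.

HB.instance Definition _ :=
  GRing.isSubalgClosed.Build R {mpoly R[m]} invariant_pred invariant_subalg.

Record invariants : Type := Invariant {
  invariant_val :> {mpoly R[m]};
  _ : invariant_val \in invariant_pred }.

HB.instance Definition _ := [isSub for invariant_val].
HB.instance Definition _ := [Choice of invariants by <:].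
HB.instance Definition _ := [SubChoice_isSubComNzRing of invariants by <:].
HB.instance Definition _ := [SubZmodule_isSubLmodule of invariants by <:].
HB.instance Definition _ :=
  [SubNzRing_SubLmodule_isSubLalgebra of invariants by <:].
HB.instance Definition _ := [SubLalgebra_isSubAlgebra of invariants by <:].

End Invariants.

Definition is_polynomial_ring (R : comNzRingType) (A : comAlgType R) : Prop :=
  exists (r : nat) (phi : {lrmorphism {mpoly R[r]} -> A}), bijective phi.

(* Craig's theorem: the conjugated matrices are integral and do define a
   representation. F_k is the transposition (k, k+1) acting on
   Q^n / (1, ..., 1), whose (n - k)-th basis vector is e_1 + ... + e_k;
   Q lifts that quotient to Q^n and P is the projection onto it. *)
Section CraigTheorem.

Variables (m e d : nat).
Hypothesis d_gt0 : (0 < d)%N.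
Hypothesis nE : m.+2 = (e * d)%N.

Local Notation n := m.+2.

Let Q : 'M[rat]_(n, m.+1) := \matrix_(a, j) (a + j < m.+1)%N%:R.
Let P : 'M[rat]_(m.+1, n) :=
  \matrix_(j, a) ((a + j == m)%N%:R - (a + j == m.+1)%N%:R).

Let mulP (p : nat) (B : 'M[rat]_(n, p)) j c :
  (P *m B) j c = B (inord (m - j)) c - B (inord (m.+1 - j)) c.
Proof.
rewrite mxE.
under eq_bigr => a _ do rewrite mxE mulrBl.
have ltj := ltn_ord j.
rewrite sumrB; congr (_ - _).
  rewrite (bigD1 (inord (m - j))) //= inordK; last lia.
  rewrite big1 => [|a neq]; first by rewrite subnK ?eqxx ?mul1r ?addr0 //; lia.
  case: eqP => [eq|]; last by rewrite mul0r.
  by case/eqP: neq; apply: val_inj; rewrite /= inordK; lia.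
rewrite (bigD1 (inord (m.+1 - j))) //= inordK; last lia.
rewrite big1 => [|a neq]; first by rewrite subnK ?eqxx ?mul1r ?addr0 //; lia.
case: eqP => [eq|]; last by rewrite mul0r.
by case/eqP: neq; apply: val_inj; rewrite /= inordK; lia.
Qed.

Let PQ : P *m Q = 1%:M.
Proof.
apply/matrixP => j k; rewrite mulP !mxE.
have ltj := ltn_ord j; have ltk := ltn_ord k.
rewrite !inordK; [|lia..].
rewrite -(inj_eq val_inj) /=.
by case: (ltngtP j k) => h; do 2?case: ltnP => ?; rewrite ?subrr ?subr0 //; lia.
Qed.

Let ones : 'cV[rat]_n := const_mx 1.
Let P1 : P *m ones = 0.
Proof. by apply/matrixP => j c; rewrite mulP !mxE subrr. Qed.

Let QP : Q *m P = 1%:M - ones *m delta_mx 0 ord_max.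
Proof.
apply/matrixP => a b; rewrite !mxE big_ord1 !mxE mul1r eqxx /=.
rewrite -!(inj_eq val_inj) /=.
have lta := ltn_ord a; have ltb := ltn_ord b.
under eq_bigr => j _ do rewrite !mxE mulrBr.
rewrite sumrB.
have S1 (f : nat -> rat) (p : nat) : \sum_(j < m.+1) f j * (b + j == p)%N%:R
    = if (p - b < m.+1)%N && (b <= p)%N then f (p - b)%N else 0.
  case: ifP => [/andP [h1 h2]|/negbT h].
    rewrite (bigD1 (Ordinal h1)) //= subnKC // eqxx mulr1 big1 ?addr0 // => j.
    rewrite -(inj_eq val_inj) /= => /eqP hj.
    by case: eqP => [|_]; rewrite ?mulr0 //; lia.
  apply: big1 => j _; have ltj := ltn_ord j.
  by case: eqP => [|_]; rewrite ?mulr0 //; lia.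
rewrite (S1 (fun j => (a + j < m.+1)%N%:R)) (S1 (fun j => (a + j < m.+1)%N%:R)).
have -> : (m - b < m.+1)%N && (b <= m)%N = (b <= m)%N by lia.
have -> : (m.+1 - b < m.+1)%N && (b <= m.+1)%N = (0 < b)%N by lia.
have -> : (a + (m - b) < m.+1)%N = (if (b <= m)%N then (a <= b)%N else (a <= m)%N) by case: ifP; lia.
have -> : (a + (m.+1 - b) < m.+1)%N = (a < b)%N by lia.
have -> : (b == m.+1 :> nat) = ~~ (b <= m)%N by lia.
have -> : (a == b :> nat) = (a <= b)%N && ~~ (a < b)%N by lia.
have : (a < b)%N ==> (a <= b)%N && (0 < b)%N by lia.
have : ~~ (b <= m)%N ==> (a <= b)%N && (0 < b)%N by lia.
have : (0 < b)%N || ~~ (a < b)%N by lia.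
case: (leqP a b) => h1; case: (ltnP a b) => h2; case: (leqP b m) => h3;
  case: (posnP b) => h4 //=; rewrite ?subr0 ?subrr ?sub0r //.
Qed.

Let A (s : 'S_n) : 'M[rat]_n := perm_mx s.

Let A1 s : A s *m ones = ones.
Proof. by rewrite -row_permE; apply/matrixP=> a b; rewrite !mxE. Qed.

Let std (s : 'S_n) : 'M[rat]_m.+1 := P *m A s *m Q.

Let std1 : std 1%g = 1%:M.
Proof. by rewrite /std /A perm_mx1 mulmx1 PQ. Qed.

Let stdM s t : std (s * t)%g = std s *m std t.
Proof.
rewrite /std /A perm_mxM -!/(A _) !mulmxA -(mulmxA _ Q P) QP.
rewrite mulmxBr mulmx1 !mulmxA -(mulmxA P (A s) ones) A1 P1 !mul0mx.
by rewrite subr0.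
Qed.

Let stdF k (i j : 'I_n) : i.+1 = k -> j = k :> nat ->
  std (tperm i j) = craigF n k.
Proof.
move=> ik jk; have ltj := ltn_ord j.
have nij : i != j by apply/eqP => E; move: jk; rewrite -E; lia.
have AE : A (tperm i j) =
    1%:M - (delta_mx i 0 - delta_mx j 0) *m (delta_mx 0 i - delta_mx 0 j : 'rV__).
  apply/matrixP => a b; rewrite !mxE big_ord1 !mxE !eqxx !andbT.
  rewrite (eq_sym a b) (eq_sym _ b) /=.
  case: tpermP => [->|->|/eqP/negPf ai /eqP/negPf aj].
  - by rewrite eqxx (negPf nij) /=; ring.
  - by rewrite eqxx (eq_sym j i) (negPf nij) /=; ring.
  - by rewrite ai aj /=; ring.
have Pa : P *m (delta_mx i 0 - delta_mx j 0) = col i P - col j P.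
  by rewrite mulmxBr -!colE.
have aQ : (delta_mx 0 i - delta_mx 0 j) *m Q = row i Q - row j Q.
  by rewrite mulmxBl -!rowE.
rewrite /std AE mulmxBr mulmx1 mulmxBl PQ mulmxA Pa -mulmxA aQ /craigF.
apply/matrixP => r c; rewrite !mxE big_ord1 !mxE.
have ltr := ltn_ord r; have ltc := ltn_ord c.
rewrite jk -ik -(inj_eq val_inj) /=.
have -> : (i + c < m.+1)%N%:R - (i.+1 + c < m.+1)%N%:R
   = (c.+1 == n - i.+1)%N%:R :> rat.
  by do 2?case: ltnP => ?; case: eqP => ?; rewrite ?subr0 ?subrr //; lia.
have -> : (i.+1 + r == m)%N = (r.+1 == n - i.+1 - 1)%N by lia.
have -> : (i.+1 + r == m.+1)%N = (r.+1 == n - i.+1)%N by lia.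
have -> : (i + r == m)%N = (r.+1 == n - i.+1)%N by lia.
have -> : (i + r == m.+1)%N = (r.+1 == n - i.+1 + 1)%N by lia.
by rewrite -!mulnb !natrM; ring.
Qed.

Let V : 'M[rat]_m.+1 := craigV n d.

Let VE r c : V r c = if r == 0 then (if c == 0 then d%:R else (m.+1 - c)%N%:R)
  else (r == c)%:R.
Proof.
rewrite /V /craigV !mxE summxE.
have ltc := ltn_ord c; have ltr := ltn_ord r.
rewrite -!(inj_eq val_inj) /=.
transitivity (d%:R * ((r == 0 :> nat) && (c == 0 :> nat))%:R
  + (if (0 < c)%N then (r == c :> nat)%:R
        + (r == 0 :> nat)%:R * (m.+1 - c)%N%:R else 0) : rat).
  rewrite !eqSS; congr (_ + _).
  case: ifP => c0.
    rewrite (bigD1_seq c.+1) ?mem_index_iota ?iota_uniq //=; last lia.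
    rewrite !mxE eqxx !andbT !eqSS mulrC subSS big1 ?addr0 // => i /negPf ne.
    by rewrite !mxE (eq_sym c.+1) ne !andbF mulr0 addr0.
  rewrite big_nat big1 // => i hi.
  rewrite !mxE (_ : (c.+1 == i) = false); last lia.
  by rewrite !andbF mulr0 addr0.
case: (posnP c) => [->|c0]; first by case: eqP => _; rewrite ?mulr1 ?mulr0 ?addr0.
rewrite andbC; case: (eqVneq (r : nat) 0) => [->|_].
  by rewrite [0 == _]eq_sym; case: eqP => [|_] /=; [lia|ring].
by rewrite /=; ring.
Qed.

Let d_neq0 : d%:R != 0 :> rat. Proof. by rewrite pnatr_eq0 -lt0n. Qed.

Let c : 'rV[rat]_m.+1 := \row_j (m.+1 - j)%N%:R.
Let u : 'rV[rat]_m.+1 :=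
  \row_j (if j == 0 then m.+1 else (e * (m.+1 - j))%N)%:R.
Let e0 : 'cV[rat]_m.+1 := delta_mx 0 0.
Let e00 : 'M[rat]_m.+1 := delta_mx 0 0.
Let W : 'M[rat]_m.+1 := 1%:M - e00 + e%:R *: e00 - d%:R^-1 *: (e0 *m c).

Let nER : m.+2%:R = e%:R * d%:R :> rat. Proof. by rewrite nE natrM. Qed.

Let cE i j : c i j = (m.+1 - j)%N%:R. Proof. by rewrite mxE. Qed.
Let uE i j : u i j = (if j == 0 then m.+1 else (e * (m.+1 - j))%N)%:R.
Proof. by rewrite mxE. Qed.

Let cV : c *m V = d%:R *: u.
Proof.
apply/matrixP => i k.
rewrite [RHS]mxE uE [LHS]mxE big_ord_recl VE cE eqxx subn0.
have -> : \sum_(a < m) c i (lift ord0 a) * V (lift ord0 a) k =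
    if k == 0 then 0 else (m.+1 - k)%N%:R.
  under eq_bigr => a _ do rewrite cE VE.
  case: (unliftP ord0 k) => [k' ->|->].
    rewrite (bigD1 k') //= big1 => [|a ne].
      by rewrite eqxx /= mulr1 addr0.
    by rewrite (inj_eq (@lift_inj _ _)) (negPf ne) mulr0.
  by rewrite big1 // => a _; rewrite /= mulr0.
case: eqP => _; first by rewrite addr0 mulrC.
rewrite natrM mulrA (mulrC d%:R) -nER -[m.+2%:R]natr1; ring.
Qed.

Let WVE (X : 'M[rat]_m.+1) : W *m X = X - e00 *m X + e%:R *: (e00 *m X)
    - d%:R^-1 *: (e0 *m (c *m X)).
Proof. by rewrite mulmxBl mulmxDl mulmxBl mul1mx -!scalemxAl mulmxA. Qed.

Let e00E p (X : 'M[rat]_(m.+1, p)) r k :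
  (e00 *m X) r k = (r == 0)%:R * X 0 k.
Proof.
rewrite mxE (bigD1 0) //= big1 => [|a /negPf ne].
  by rewrite mxE andbT addr0.
by rewrite mxE ne andbF mul0r.
Qed.

Let e0E p (X : 'rV[rat]_p) r k : (e0 *m X) r k = (r == 0)%:R * X 0 k.
Proof. by rewrite mxE big_ord1 mxE andbT. Qed.

Let WV : W *m V = 1%:M.
Proof.
rewrite WVE cV -scalemxAr scalerA mulVf // scale1r.
apply/matrixP => r k.
have mxC (X Y Z : 'M[rat]_m.+1) : (X - Y + e%:R *: Y - Z) r k =
  X r k - Y r k + e%:R * Y r k - Z r k by rewrite !mxE.
rewrite mxC e00E e0E !VE uE eqxx [RHS]mxE.
case: (eqVneq r 0) => [->|_]; last by rewrite /=; ring.
rewrite (eq_sym 0 k); case: (eqVneq k 0) => _ /=.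
  by rewrite !mul1r subrr add0r -nER -[m.+2%:R]natr1; ring.
by rewrite natrM; ring.
Qed.

Let cP : c *m P = ones^T - m.+2%:R *: delta_mx 0 ord_max.
Proof.
apply/matrixP => i a; rewrite !mxE (ord1 i) /=.
rewrite -(inj_eq val_inj) /=.
have lta := ltn_ord a.
under eq_bigr => j _ do rewrite !mxE mulrBr.
rewrite sumrB.
have S1 (f : nat -> rat) (p : nat) : \sum_(j < m.+1) f j * (a + j == p)%N%:R
    = if (p - a < m.+1)%N && (a <= p)%N then f (p - a)%N else 0.
  case: ifP => [/andP [h1 h2]|/negbT h].
    rewrite (bigD1 (Ordinal h1)) //= subnKC // eqxx mulr1 big1 ?addr0 // => j.
    rewrite -(inj_eq val_inj) /= => /eqP hj.
    by case: eqP => [|_]; rewrite ?mulr0 //; lia.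
  apply: big1 => j _; have ltj := ltn_ord j.
  by case: eqP => [|_]; rewrite ?mulr0 //; lia.
rewrite (S1 (fun j => (m.+1 - j)%N%:R)) (S1 (fun j => (m.+1 - j)%N%:R)).
have -> : (m - a < m.+1)%N && (a <= m)%N = (a <= m)%N by lia.
have -> : (m.+1 - a < m.+1)%N && (a <= m.+1)%N = (0 < a)%N by lia.
case: (posnP a) => [->|a0].
  by rewrite /= subn0 subSnn; ring.
rewrite subKn; last lia.
case: leqP => h.
  have -> : (a == m.+1 :> nat) = false by lia.
  have -> : (m.+1 - (m - a))%N = a.+1 by lia.
  by rewrite -[a.+1%:R]natr1 /=; ring.
have -> : (a : nat) = m.+1 by lia.
by rewrite eqxx /= -[m.+2%:R]natr1; ring.
Qed.

Let oneQ : ones^T *m Q = c.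
Proof.
apply/matrixP => i j; rewrite cE mxE.
have ltj := ltn_ord j.
under eq_bigr => a _ do rewrite !mxE mul1r.
rewrite -natr_sum; congr (_%:R).
transitivity (\sum_(a < m.+2 | (a < m.+1 - j)%N) 1)%N.
  by rewrite [RHS]big_mkcond; apply: eq_bigr => a _;
    rewrite (_ : (a + j < m.+1)%N = (a < m.+1 - j)%N); [case: ifP|lia].
rewrite -(big_ord_widen m.+2 (fun=> 1%N)); last lia.
by rewrite sum1_card card_ord.
Qed.

Let N (s : 'S_m.+2) : 'M[rat]_m.+1 := W *m std s *m V.

Let NE s : N s = std s *m V - e00 *m (std s *m V) + e%:R *: (e00 *m (std s *m V))
  - e0 *m u + e%:R *: (e0 *m (delta_mx 0 ord_max *m A s *m Q *m V)).
Proof.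
have cS : c *m (std s *m V) = d%:R *: u
    - m.+2%:R *: (delta_mx 0 ord_max *m A s *m Q *m V).
  rewrite /std !mulmxA cP !mulmxBl -!scalemxAl.
  have -> : ones^T *m A s = ones^T.
    rewrite /A -[s]invgK -col_permE.
    by apply/matrixP => i j; rewrite !mxE.
  by rewrite oneQ cV.
rewrite /N -mulmxA WVE cS mulmxBr scalerBr -!scalemxAr !scalerA mulVf //.
by rewrite scale1r nER mulrCA mulVf // mulr1 opprB addrA addrAC.
Qed.

Let intmx p q (X : 'M[rat]_(p, q)) := X \is a mxOver Num.int.

Let intmxM p q r (X : 'M[rat]_(p, q)) (Y : 'M[rat]_(q, r)) :
  intmx X -> intmx Y -> intmx (X *m Y).
Proof. exact: mxOverM. Qed.

Let N_int s : intmx (N s).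
Proof.
have natE (b : nat) : (b%:R : rat) \in Num.int by exact: natr_int.
have V_int : intmx V.
  by apply/mxOverP => i j; rewrite VE; do 2?case: ifP.
have Q_int : intmx Q by apply/mxOverP => i j; rewrite mxE.
have P_int : intmx P by apply/mxOverP => i j; rewrite mxE rpredB.
have A_int : intmx (A s) by apply/mxOverP => i j; rewrite !mxE.
have u_int : intmx u by apply/mxOverP => i j; rewrite mxE.
have d_int p q i j : intmx (delta_mx i j : 'M_(p, q)).
  by apply/mxOverP => a b; rewrite mxE.
have S_int : intmx (std s *m V) :=
  intmxM (intmxM (intmxM P_int A_int) Q_int) V_int.
have T_int : intmx (delta_mx 0 ord_max *m A s *m Q *m V : 'rV_m.+1) :=
  intmxM (intmxM (intmxM (d_int 1 _ 0 _) A_int) Q_int) V_int.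
have intD (X Y : 'M[rat]_m.+1) : intmx X -> intmx Y -> intmx (X + Y).
  by move=> /mxOverP h /mxOverP h'; apply/mxOverP=> i j; rewrite mxE rpredD.
have intN (X : 'M[rat]_m.+1) : intmx X -> intmx (- X).
  by move=> /mxOverP h; apply/mxOverP=> i j; rewrite mxE rpredN.
have intZ (X : 'M[rat]_m.+1) : intmx X -> intmx (e%:R *: X).
  by move=> /mxOverP h; apply/mxOverP=> i j; rewrite mxE rpredM.
have X_int := intmxM (d_int _ _ 0 0 : intmx e00) S_int.
have Y_int := intmxM (d_int _ _ 0 0 : intmx e0) u_int.
have Z_int := intmxM (d_int _ _ 0 0 : intmx e0) T_int.
rewrite NE.
apply: (intD); last exact: intZ Z_int.
apply: (intD); last exact: intN Y_int.
apply: (intD); last exact: intZ X_int.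
by apply: (intD); last exact: intN X_int.
Qed.

Lemma craig_rep_exists_aux : exists L : mx_representation int [set: 'S_m.+2] m.+1,
  @is_craig_rep m.+2 d L.
Proof.
pose L s := map_mx Num.floor (N s) : 'M[int]_m.+1.
have LE s : map_mx intr (L s) = N s.
  apply/matrixP => i j; rewrite [LHS]mxE [X in X%:~R]mxE; apply: floorK.
  exact: (mxOverP (N_int s)).
have inj : injective (map_mx (intr : int -> rat) : 'M_m.+1 -> 'M_m.+1).
  move=> X Y /matrixP E; apply/matrixP => i j.
  by have := E i j; rewrite !mxE; apply: intr_inj.
have Lrepr : mx_repr [set: 'S_m.+2] L.
  split=> [|s t _ _]; apply: inj.
    by rewrite map_mx1 LE /N std1 mulmx1 WV.
  rewrite map_mxM !LE /N stdM !mulmxA -(mulmxA _ V W).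
  by rewrite (mulmx1C WV) mulmx1.
exists (MxRepresentation Lrepr) => k i j ik jk /=.
rewrite LE /N (stdF ik jk); congr (_ *m _ *m _).
have uV : craigV m.+2 d \in unitmx by case/mulmx1_unit: WV.
by rewrite -[LHS]mulmx1 -(mulmxV uV) mulmxA WV mul1mx.
Qed.

End CraigTheorem.

Lemma craig_rep_exists (n d : nat) : (3 <= n)%N -> (0 < d)%N -> (d %| n)%N ->
  exists L : mx_representation int [set: 'S_n] n.-1, is_craig_rep d L.
Proof.
case: n => [//|[//|m]] _ d_gt0 /dvdnP [e nE].
exact: craig_rep_exists_aux d_gt0 nE.
Qed.

(* Main.v *)
From HB Require Import structures.
Require Import Defs.
From mathcomp Require Import all_boot all_order all_algebra all_fingroup.
From mathcomp Require Import mxrepresentation.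
From mathcomp Require Import mpoly.
From mathcomp Require Import zify ring.
From Stdlib Require Import Classical.

Set Implicit Arguments.
Unset Strict Implicit.
Unset Printing Implicit Defensive.

Import GRing.Theory Num.Theory.

Local Open Scope ring_scope.

(** Put e = n / d, so that d / n \in R says that e is invertible in R. Over the
    rationals Craig's representation is the quotient of Q^n by its diagonal, and
    the coordinates of Q^n, corrected by their mean, are n linear forms x_a with
    sum zero that S_n permutes. On the lattice L_d the forms e x_a and x_a - x_b
    take integral values; [coord_mx_act] expresses this in terms of the given
    matrices, and it is all that the rest of the proof knows about L_d.

    If e is invertible in R, the x_a themselves are linear forms over R, and R[L_d]
    is R[x_1, ..., x_n] / (x_1 + ... + x_n). Its invariants are the polynomials in
    the elementary symmetric polynomials e_2, ..., e_n of the x_a.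
    - Generation ([basic_invariant_surj]): let E be the ring generated by
      e_2, ..., e_n. An invariant f is symmetric in the first n - 1 forms, so it is
      a polynomial in the coefficients of prod_(a < n) (T - x_a), which is the
      quotient of prod_a (T - x_a) by T - x_n. Hence f = A(x_n) with A \in E[T],
      and A may be taken of degree less than n. By invariance A takes the value f at
      the n distinct elements x_a, so A is constant and f \in E.
    - Independence ([elemsym_sum_zero_indep]): a relation between the e_k becomes,
      in independent variables, a symmetric polynomial divisible by the first
      elementary symmetric polynomial. The quotient is symmetric too, and the
      fundamental theorem of symmetric polynomials shows that the relation is
      trivial.

    If e is not invertible in R, some prime p dividing e is not, and R reduces to
    F_p. As e x_a - e x_b is divisible by p, all the e x_a reduce to one linear form
    g, which is therefore invariant modulo p. No invariant over R reduces to g,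
    because invariants are polynomials in e_2, ..., e_n over Q and so have no linear
    part ([invariant_linear_part]). But if the ring of invariants B is a polynomial
    ring and S_n acts faithfully modulo p, every g that is invariant modulo p
    is the reduction of an invariant ([lift_invariant]). Indeed some y
    has a trace sum_s s(y) that is nonzero modulo p, and
    g * sum_s s(y) = sum_s s(g y) modulo p presents g as a fraction of the domain
    B / p B; also g ^ n! = prod_s s(g) modulo p lies in B / p B. Being a polynomial
    ring over F_p, the domain B / p B is integrally closed, so it contains g. The
    action is faithful modulo p unless n = 4 and d = 2 ([act_faithful]).

    For n = 4 and d = 2 the forms u = x_1 + x_2, v = x_1 + x_3, w = x_1 + x_4 are a
    basis of the linear forms over Z, and S_4 acts by all permutations and all even
    sign changes of u, v, w. The invariants are the polynomials in
    u^2 + v^2 + w^2, u v w and (u v)^2 + (u w)^2 + (v w)^2 ([cube_is_polynomial]). *)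

(** * The action of S_n on the coordinate forms of the lattice *)

(** In 0-based indices, the value of the form x_a on the j-th basis vector of the
    lattice is [coord_entry a j] for 0 < j and [coord_entry a 0 / e] for j = 0. The
    rows of [coord_mx] are thus the integral forms e x_a. *)
Definition coord_entry (m : nat) (a : 'I_m.+2) (j : 'I_m.+1) : int :=
  (a + j < m.+1)%N%:Z - ((a == m.+1 :> nat) * (m.+1 - j))%N%:Z.

Definition coord_mx (m e : nat) : 'M[int]_(m.+2, m.+1) :=
  \matrix_(a, j) ((if j == 0 then 1 else e%:Z) * coord_entry a j).

Section CoordinateAction.

Variables (m e d : nat).
Hypothesis d_gt0 : (0 < d)%N.
Hypothesis nE : m.+2 = (e * d)%N.

Local Notation n := m.+2.

Lemma craigVE (r c : 'I_m.+1) : craigV n d r c =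
  if r == 0 then (if c == 0 then d%:R else (m.+1 - c)%N%:R) else (r == c)%:R.
Proof.
rewrite /craigV !mxE summxE.
have ltc := ltn_ord c; have ltr := ltn_ord r.
have entry i : (craigE n i i + (n - i)%:R *: craigE n 1 i) r c
    = (c.+1 == i)%:R * ((r.+1 == i)%:R + (r == 0)%:R * (n - i)%:R) :> rat.
  rewrite !mxE eqSS -(inj_eq val_inj) /=.
  by case: eqP => _; case: eqP => _; case: eqP => _ /=; ring.
rewrite (eq_bigr _ (fun i _ => entry i)) !eqSS -!(inj_eq val_inj) /=.
case: (posnP c) => [c0 | c_gt0].
  rewrite big_nat big1 ?addr0 ?c0; last first.
    by move=> i hi; case: eqP => [|_]; [lia | rewrite mul0r].
  by case: eqP => _; rewrite ?mulr1 ?mulr0.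
rewrite (bigD1_seq c.+1) ?mem_index_iota ?iota_uniq //=; last lia.
rewrite big1 => [|i /negPf ne]; last by rewrite eq_sym ne mul0r.
rewrite eqxx !eqSS subSS andbF.
case: (@eqP _ (r : nat) 0%N) => [->|_]; rewrite ?(ltn_eqF c_gt0) /=; ring.
Qed.

Lemma craigV_unit : craigV n d \in unitmx.
Proof.
rewrite -unitmx_tr unitmxE det_trig; last first.
  apply/is_trig_mxP => i j lt_ij; rewrite mxE craigVE -!(inj_eq val_inj) /=.
  by rewrite (gtn_eqF lt_ij) (gtn_eqF (leq_ltn_trans (leq0n i) lt_ij)).
rewrite rpred_prod // => i _; rewrite mxE craigVE eqxx.
by case: (i == 0); rewrite unitfE ?oner_eq0 // pnatr_eq0 -lt0n.
Qed.

Let centred : 'M[rat]_(n, m.+1) :=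
  \matrix_(a, c) ((a + c < m.+1)%N%:R - (m.+1 - c)%N%:R / n%:R).

Lemma centred_craigV : centred *m craigV n d = e%:R^-1 *: map_mx intr (coord_mx m e).
Proof.
have e_neq0 : e%:R != 0 :> rat by rewrite pnatr_eq0; apply/eqP; lia.
have d_neq0 : d%:R != 0 :> rat by rewrite pnatr_eq0; apply/eqP; lia.
have n_neq0 : 1 + m.+1%:R != 0 :> rat.
  by rewrite nat1r pnatr_eq0.
have nER : m.+2%:R = e%:R * d%:R :> rat by rewrite nE natrM.
apply/matrixP => a c; have lta := ltn_ord a; have ltc := ltn_ord c.
rewrite mxE big_ord_recl craigVE eqxx.
have -> : \sum_(i < m) centred a (lift ord0 i) * craigV n d (lift ord0 i) c
    = if c == 0 then 0 else centred a c.
  under eq_bigr => i _ do rewrite craigVE.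
  case: (unliftP ord0 c) => [c' ->|->]; last by rewrite big1 // => i _; rewrite mulr0.
  rewrite (bigD1 c') //= eqxx mulr1 big1 ?addr0 // => i ne.
  by rewrite (inj_eq (@lift_inj _ _)) (negPf ne) mulr0.
rewrite !mxE /coord_entry rmorphM rmorphB /= -!pmulrn !natrM addn0 subn0.
have -> : (a < m.+1)%N = ~~ (a == m.+1 :> nat) by lia.
have split : (m.+1%:R = n%:R - 1 :> rat) by rewrite -(natr1 m.+1) addrK.
case: (eqVneq c 0) => [->|_] /=.
  rewrite subn0 addn0 split (_ : (a < m.+1)%N = ~~ (a == m.+1 :> nat)); last lia.
  by case: eqP => _ /=; rewrite nER; field; rewrite ?e_neq0 ?d_neq0.
by case: eqP => _ /=; rewrite -?pmulrn split nER; field; rewrite ?e_neq0 ?d_neq0.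
Qed.

(** The columns of [centred] are the vectors e_1 + ... + e_(n-i) minus their mean; for
    i = 0 and i = n this expression vanishes, in accordance with E^{0,j} = E^{n,j} = 0. *)
Lemma centred_craigE i j a c : (i <= n)%N ->
  (centred *m craigE n i j) a c
    = (c.+1 == j)%:R * ((a + i < n)%N%:R - (n - i)%N%:R / n%:R).
Proof.
move=> le_in; have lta := ltn_ord a.
have n_neq0 : n%:R != 0 :> rat by rewrite pnatr_eq0.
have [i0|i_gt0] := posnP i.
  rewrite i0 addn0 lta subn0 divff // subrr mulr0 mxE big1 // => b _.
  by rewrite !mxE mulr0.
have [i_eq|lt_in] := leqP n i.
  rewrite (_ : (a + i < n)%N = false); last lia.
  rewrite (_ : n - i = 0)%N ?mul0r ?subrr ?mulr0; last lia.
  rewrite mxE big1 // => b _; rewrite !mxE (_ : (b.+1 == i) = false) ?mulr0 //.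
  by have ltb := ltn_ord b; lia.
have lt_i : (i.-1 < m.+1)%N by lia.
rewrite mxE (bigD1 (Ordinal lt_i)) //= big1 ?addr0 => [|b ne].
  rewrite !mxE /= prednK // eqxx /= mulrC.
  by congr (_ * (_%:R - _%:R / _)); lia.
rewrite !mxE (_ : (b.+1 == i) = false) ?mulr0 //.
by apply/eqP => bi; case/eqP: ne; apply: val_inj; rewrite /= -bi.
Qed.

(** [craigF n k] replaces the column i = n - k of [centred] by the sum of its neighbours
    minus itself, and e_1 + ... + e_(k-1) + e_(k+1) is what the transposition makes of
    e_1 + ... + e_k. *)
Lemma centred_craigF k (i j : 'I_n) : i.+1 = k -> j = k :> nat ->
  centred *m craigF n k = row_perm (tperm i j) centred.
Proof.
move=> ik jk; have ltj := ltn_ord j.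
apply/matrixP => a c; have lta := ltn_ord a.
have addE (A B C D : 'M[rat]_(n, m.+1)) :
    (A + B - 2%:R *: C + D) a c = A a c + B a c - 2%:R * C a c + D a c by rewrite !mxE.
rewrite /craigF mulmxDr mulmxBr mulmxDr mulmx1 -scalemxAr addE.
rewrite !centred_craigE; [|lia..].
rewrite !mxE.
case: (eqVneq c.+1 (n - k)%N) => [ck|/eqP ck] /=; last first.
  have -> : (tperm i j a + c < m.+1)%N = (a + c < m.+1)%N; last by ring.
  by case: tpermP => [->|->|//]; rewrite jk -ik in ck *; lia.
have -> : (m.+1 - c = i.+1)%N by lia.
have -> : (n - (n - k - 1) = i.+2)%N by lia.
have -> : (n - (n - k) = i.+1)%N by lia.
have -> : (n - (n - k + 1) = i)%N by lia.
have -> : (a + c < m.+1)%N = (a < i.+1)%N by lia.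
have -> : (a + (n - k - 1) < n)%N = (a < i.+2)%N by lia.
have -> : (a + (n - k) < n)%N = (a < i.+1)%N by lia.
have -> : (a + (n - k + 1) < n)%N = (a < i)%N by lia.
have -> : (tperm i j a + c < m.+1)%N = (tperm i j a < i.+1)%N by lia.
rewrite -(natr1 i.+1) -(natr1 i).
have -> : (tperm i j a < i.+1)%N%:R
    = (a < i.+2)%N%:R - (a < i.+1)%N%:R + (a < i)%N%:R :> rat.
  case: tpermP => [->|->|ai aj]; rewrite ?jk -?ik.
  - by rewrite !ltnS ltnn leqnn leqnSn.
  - by rewrite [(i.+1 < i)%N]ltnNge !ltnS ltnn leqnn leqnSn.
  have {}ai : a <> i :> nat by move/val_inj.
  have {}aj : a <> i.+1 :> nat by rewrite ik -jk => /val_inj.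
  have -> : (a < i.+2)%N = (a < i.+1)%N by lia.
  have -> : (a < i)%N = (a < i.+1)%N by lia.
  by rewrite subrr add0r.
by field; rewrite -natrD pnatr_eq0.
Qed.

Variable L : mx_representation int [set: 'S_n] m.+1.
Hypothesis craigL : is_craig_rep d L.

(** The adjacent transpositions, for which the action is given, generate S_n. *)
Lemma coord_mx_act s : coord_mx m e *m L s = row_perm s (coord_mx m e).
Proof.
pose good (t : 'S_n) := coord_mx m e *m L t = row_perm t (coord_mx m e).
have goodM t u : good t -> good u -> good (t * u)%g.
  rewrite /good repr_mxM ?inE // mulmxA => -> Gu.
  by rewrite row_permM -Gu !row_permE mulmxA.
have good1 : good 1%g by rewrite /good repr_mx1 mulmx1 row_perm1.
have good_adj (i j : 'I_n) : j = i.+1 :> nat -> good (tperm i j).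
  move=> ji; have e_neq0 : e%:R != 0 :> rat by rewrite pnatr_eq0; apply/eqP; lia.
  have inj : injective (map_mx intr : 'M[int]_(n, m.+1) -> 'M[rat]_(n, m.+1)).
    move=> A B /matrixP E; apply/matrixP => a b.
    by have := E a b; rewrite !mxE; apply: intr_inj.
  apply: inj; rewrite map_mxM (craigL (k := i.+1)) //.
  have CE : map_mx intr (coord_mx m e) = e%:R *: (centred *m craigV n d).
    by rewrite centred_craigV scalerA divff // scale1r.
  rewrite map_row_perm CE -!scalemxAl !mulmxA (mulmxK craigV_unit).
  rewrite (centred_craigF (i := i) (j := j)) //.
  by rewrite !row_permE -scalemxAr mulmxA.
have good_tperm (i j : 'I_n) : good (tperm i j).
  wlog lt_ij : i j / (i < j)%N.
    move=> wl; case: (ltngtP i j) => [|gt|/val_inj->]; first exact: wl.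
      by rewrite tpermC; apply: wl.
    by rewrite tperm1.
  have [k] : exists k, j = (i + k.+1)%N :> nat.
    by exists (j - i).-1; lia.
  elim: k j lt_ij => [|k IH] j lt_ij jE; first by apply: good_adj; lia.
  have ltj' : (i + k.+1 < n)%N by have := ltn_ord j; lia.
  have adj : good (tperm (Ordinal ltj') j) by apply: good_adj; rewrite /=; lia.
  have -> : tperm i j = (tperm i (Ordinal ltj') ^ tperm (Ordinal ltj') j)%g.
    by rewrite tpermJ tpermL tpermD // -(inj_eq val_inj) /=; lia.
  rewrite conjgE tpermV; apply: (goodM); first exact: adj.
  apply: (goodM); last exact: adj.
  by apply: IH => //=; lia.
have [ts -> _] := prod_tpermP s.
by elim/big_rec : _ => // t u _; apply: goodM.
Qed.
End CoordinateAction.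

(** * Substitution into polynomials and elementary symmetric expressions *)

Section Substitution.

Variables (R : comNzRingType) (n : nat).

Lemma mpoly_ring_ind (P : {mpoly R[n]} -> Prop) :
    (forall c, P c%:MP) -> (forall i, P 'X_i) ->
    (forall p q, P p -> P q -> P (p + q)) ->
    (forall p q, P p -> P q -> P (p * q)) ->
  forall p, P p.
Proof.
move=> PC PX PD PM; apply: mpolyind => [|c k p _ _ Pp]; first exact: (PC 0).
apply: (PD) => //; rewrite -mul_mpolyC; apply: (PM); first exact: PC.
rewrite mpolyXE_id; elim/big_rec : _ => [|i q _ Pq]; first exact: (PC 1).
apply: (PM) => //; elim: (k i) => [|l IH]; first exact: (PC 1).
by rewrite exprS; apply: (PM).
Qed.

Lemma mpoly_rmorph_ext (A : comNzRingType) (f g : {rmorphism {mpoly R[n]} -> A}) :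
  (forall c, f c%:MP = g c%:MP) -> (forall i, f 'X_i = g 'X_i) -> f =1 g.
Proof.
move=> eqC eqX; apply: mpoly_ring_ind => // p q eqp eqq.
  by rewrite !rmorphD eqp eqq.
by rewrite !rmorphM eqp eqq.
Qed.

Lemma comp_mpolyU k (x : 'I_n -> {mpoly R[k]}) i :
  'X_i \mPo [tuple x i | i < n] = x i.
Proof. by rewrite comp_mpolyXU -tnth_nth tnth_mktuple. Qed.

Lemma comp_mpoly_comp k l (x : 'I_n -> {mpoly R[k]}) (y : k.-tuple {mpoly R[l]}) p :
  (p \mPo [tuple x i | i < n]) \mPo y = p \mPo [tuple x i \mPo y | i < n].
Proof.
pose f : {rmorphism {mpoly R[n]} -> {mpoly R[l]}} :=
  (comp_mpoly y \o comp_mpoly [tuple x i | i < n])%FUN.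
apply: (mpoly_rmorph_ext (f := f)) => [c|i] /=; first by rewrite !comp_mpolyC.
by rewrite !comp_mpolyU.
Qed.

Lemma eq_comp_mpoly k (x y : 'I_n -> {mpoly R[k]}) p : x =1 y ->
  p \mPo [tuple x i | i < n] = p \mPo [tuple y i | i < n].
Proof. by move=> eqxy; congr (_ \mPo _); apply: eq_mktuple. Qed.

End Substitution.

Lemma map_comp_mpoly (R K : comNzRingType) (f : {rmorphism R -> K}) n k
    (x : 'I_n -> {mpoly R[k]}) (p : {mpoly R[n]}) :
  map_mpoly f (p \mPo [tuple x i | i < n])
    = map_mpoly f p \mPo [tuple map_mpoly f (x i) | i < n].
Proof.
elim/mpoly_ring_ind: p => [c|i|p q IHp IHq|p q IHp IHq].
- by rewrite comp_mpolyC !map_mpolyC comp_mpolyC.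
- by rewrite map_mpolyX !comp_mpolyU.
- by rewrite !rmorphD /= IHp IHq.
- by rewrite !rmorphM /= IHp IHq.
Qed.

Lemma map_mpoly_inj (R K : comNzRingType) (f : {rmorphism R -> K}) k : injective f ->
  injective (map_mpoly f : {mpoly R[k]} -> {mpoly K[k]}).
Proof.
by move=> inj_f p q /mpolyP E; apply/mpolyP => l; apply: inj_f; rewrite -!mcoeff_map_mpoly.
Qed.

Section ElementarySymmetric.

Variable n : nat.
Implicit Types A B : comNzRingType.

(** The value of [mesym n R k] at x, in any commutative ring; this form makes it obvious
    that ring morphisms and permutations of x commute with it. *)
Definition elemsym A (x : 'I_n -> A) (k : nat) : A :=
  \sum_(h : {set 'I_n} | #|h| == k) \prod_(i in h) x i.

Lemma rmorph_elemsym A B (f : {rmorphism A -> B}) (x : 'I_n -> A) k :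
  f (elemsym x k) = elemsym (fun i => f (x i)) k.
Proof. by rewrite rmorph_sum; apply: eq_bigr => h _; rewrite rmorph_prod. Qed.

Lemma eq_elemsym A (x y : 'I_n -> A) k : x =1 y -> elemsym x k = elemsym y k.
Proof. by move=> eqxy; apply: eq_bigr => h _; apply: eq_bigr => i _. Qed.

Lemma elemsym_perm A (x : 'I_n -> A) (s : 'S_n) k : elemsym (fun i => x (s i)) k = elemsym x k.
Proof.
rewrite /elemsym [RHS](reindex_inj (imset_inj (@perm_inj _ s))) /=.
apply: eq_big => [h|h _]; first by rewrite card_imset //; apply: perm_inj.
by rewrite big_imset //= => i j _ _; apply: perm_inj.
Qed.

Lemma comp_mesym (R : comNzRingType) k (x : 'I_n -> {mpoly R[k]}) l :
  mesym n R l \mPo [tuple x i | i < n] = elemsym x l.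
Proof.
rewrite (rmorph_elemsym (comp_mpoly _) (fun i => 'X_i)).
by apply: eq_elemsym => i; rewrite /= comp_mpolyU.
Qed.

Lemma elemsym0 A (x : 'I_n -> A) : elemsym x 0 = 1.
Proof.
rewrite /elemsym (bigD1 set0) ?cards0 //= big_set0 big1 ?addr0 // => h.
by rewrite cards_eq0 => /andP [->].
Qed.

Lemma elemsym1 A (x : 'I_n -> A) : elemsym x 1 = \sum_i x i.
Proof.
have := congr1 (mmap intr x) (mesym1E n int).
rewrite (rmorph_elemsym (mmap intr x) (fun i => 'X_i)) rmorph_sum /= => E.
rewrite (eq_elemsym (y := fun i => mmap intr x 'X_i)); last by move=> i; rewrite mmapX mmap1U.
by rewrite E; apply: eq_bigr => i _; rewrite mmapX mmap1U.
Qed.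

Lemma prod_XsubC_elemsym A (x : 'I_n -> A) :
  \prod_i ('X - (x i)%:P) = \sum_(k < n.+1) ((-1) ^+ k * elemsym x k)%:P * 'X^(n - k).
Proof.
have := congr1 (map_poly (mmap intr x)) (Viete n).
rewrite rmorph_prod rmorph_sum /= => E.
transitivity (\prod_(i < n) (map_poly (mmap intr x) ('X - ('X_i)%:P))).
  by apply: eq_bigr => i _; rewrite rmorphB /= map_polyX map_polyC /= mmapX mmap1U.
rewrite E; apply: eq_bigr => k _.
rewrite -!mul_polyC !rmorphM /= map_polyXn !map_polyC /= rmorphXn rmorphN1 mulrA.
rewrite (rmorph_elemsym (mmap intr x) (fun i => 'X_i)); congr (_ * _%:P * _).
by apply: eq_elemsym => i; rewrite /= mmapX mmap1U.
Qed.

End ElementarySymmetric.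

(** * Invariants of the permutations of n forms with sum zero: generation *)

(** If all the x_a are roots of a monic P over D and A takes the same value f at each of
    them, the remainder of A by P has too small a degree to be anything but the
    constant f; hence f comes from D. The domain T only serves to bound the number of
    roots, as S itself need not be a domain. *)
Lemma root_descent (D S : comNzRingType) (T : idomainType)
    (theta : {rmorphism D -> S}) (j : {rmorphism S -> T}) (I : finType)
    (x : I -> S) (P A : {poly D}) (f : S) :
  injective j -> injective x -> P \is monic -> (1 < size P <= #|I|.+1)%N ->
  (forall a, root (map_poly theta P) (x a)) ->
  (forall a, (map_poly theta A).[x a] = f) -> exists c, theta c = f.
Proof.
move=> inj_j inj_x monP /andP [P_gt1 P_le] rootP valA.
pose r := Pdiv.Ring.rmodp A P.
have Pneq0 : P != 0 by rewrite -size_poly_gt0 ltnW.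
have valr a : (map_poly theta r).[x a] = f.
  have := congr1 (map_poly theta) (Pdiv.RingMonic.rdivp_eq monP A).
  move=> /(congr1 (horner^~ (x a))); rewrite valA rmorphD rmorphM hornerD hornerM.
  by rewrite (eqP (rootP a)) mulr0 add0r.
have size_r : (size r <= #|I|)%N.
  by rewrite -ltnS (leq_trans _ P_le) // Pdiv.Ring.ltn_rmodpN0.
exists r`_0; apply: (inj_j).
pose q : {poly T} := map_poly (j \o theta) r - (j f)%:P.
have q0 : q = 0.
  apply: (@roots_geq_poly_eq0 _ q [seq j (x a) | a : I]).
  - apply/allP => _ /codomP [a ->].
    by rewrite rootE hornerD hornerN hornerC map_poly_comp horner_map valr subrr.
  - by rewrite map_inj_uniq ?enum_uniq // => a b /inj_j/inj_x.
  rewrite size_map -cardE (leq_trans (size_polyD _ _)) // geq_max size_polyN.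
  rewrite (leq_trans (size_poly _ _) size_r) (leq_trans (size_polyC_leq1 _)) //.
  by rewrite -ltnS (leq_trans P_gt1).
have := congr1 (fun p : {poly T} => p`_0) q0.
by rewrite coefB coefC eqxx coef0 coef_map /= => /eqP; rewrite subr_eq0 => /eqP.
Qed.

(** The forms t_j express the variables in terms of the first n - 1 of the forms x_a, so
    that these are coordinates; the last one is minus the sum of the others. *)
Section SumZeroCoordinates.

Variables (R : comNzRingType) (K : idomainType) (iota : {rmorphism R -> K}).
Hypothesis inj_iota : injective iota.

Variable m : nat.
Hypothesis m_gt0 : (0 < m)%N.

Local Notation n := m.+2.
Local Notation S := {mpoly R[m.+1]}.
Local Notation w := (widen_ord (leqnSn m.+1)).

Variables (x : 'I_n -> S) (t : 'I_m.+1 -> S).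
Hypothesis sum_x : \sum_a x a = 0.
Hypothesis t_x : forall j, t j \mPo [tuple x (w i) | i < m.+1] = 'X_j.
Hypothesis x_t : forall i, x (w i) \mPo [tuple t j | j < m.+1] = 'X_i.

Lemma widen_lift (i : 'I_m.+1) : w i = lift ord_max i.
Proof. by apply: ord_inj; rewrite lift_max. Qed.

Lemma sum_zero_last : x ord_max = - \sum_i x (w i).
Proof. by apply/eqP; rewrite -addr_eq0 addrC -(big_ord_recr _ x) /= sum_x. Qed.

Lemma sum_zero_inj : injective x.
Proof.
have inj_w i i' : x (w i) = x (w i') -> i = i'.
  move/(congr1 (fun p => (p \mPo [tuple t j | j < m.+1])@_U_(i'))).
  rewrite !x_t !mcoeffXU eqxx; case: eqP => // _ /eqP.
  by rewrite eq_sym oner_eq0.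
have last_w i : x (w i) <> x ord_max.
  rewrite sum_zero_last; have [i' ne] : exists i', i' != i.
    case: (eqVneq i ord0) => [->|ne]; last by exists ord0; rewrite eq_sym.
    by exists ord_max; rewrite -val_eqE /= -lt0n.
  move/(congr1 (fun p => (p \mPo [tuple t j | j < m.+1])@_U_(i'))).
  rewrite rmorphN rmorph_sum /= (eq_bigr _ (fun i _ => x_t i)) x_t.
  rewrite mcoeffN raddf_sum (bigD1 i') //= big1 => [|j nj].
    by rewrite !mcoeffXU eqxx eq_sym (negPf ne) addr0 => /eqP;
      rewrite eq_sym oppr_eq0 oner_eq0.
  by rewrite mcoeffXU (negPf nj).
move=> a b; case: (unliftP ord_max a) => [a'|] ->; case: (unliftP ord_max b) => [b'|] -> //;
  rewrite -?widen_lift.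
- by move/inj_w->.
- by move/last_w.
- by move/esym/last_w.
Qed.

Definition basic_invariant : {mpoly R[m.+1]} -> S :=
  comp_mpoly [tuple elemsym x k.+2 | k < m.+1].

HB.instance Definition _ := GRing.RMorphism.copy basic_invariant
  (comp_mpoly [tuple elemsym x k.+2 | k < m.+1]).
HB.instance Definition _ := GRing.Linear.copy basic_invariant
  (comp_mpoly [tuple elemsym x k.+2 | k < m.+1]).

Lemma basic_invariantX k : basic_invariant 'X_k = elemsym x k.+2.
Proof. exact: comp_mpolyU. Qed.

Let tail : {poly {mpoly R[m.+1]}} :=
  \sum_(k < m.+1) ((-1) ^+ k * 'X_k)%:P * 'X^(m - k).

Let P : {poly {mpoly R[m.+1]}} := 'X^n + tail.

Lemma basic_invariant_poly : map_poly basic_invariant P = \prod_a ('X - (x a)%:P).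
Proof.
rewrite prod_XsubC_elemsym 2!big_ord_recl /= elemsym0 elemsym1 sum_x.
rewrite !mulr0 mul0r add0r !mul1r rmorphD rmorph_sum /= map_polyXn.
congr (_ + _); apply: eq_bigr => k _.
rewrite [LHS]rmorphM /= map_polyXn map_polyC /= rmorphM rmorphXn rmorphN1.
rewrite [X in (_ * X)%:P]basic_invariantX.
by rewrite /bump /= !add1n !exprS !mulN1r opprK !subSS.
Qed.

Let size_tail : (size tail < n.+1)%N.
Proof.
rewrite ltnS (leq_trans (size_sum _ _ _)) //; apply/bigmax_leqP => k _.
rewrite mul_polyC (leq_trans (size_scale_leq _ _)) // size_polyXn.
by rewrite !ltnS (leq_trans (leq_subr _ _)).
Qed.

Lemma basic_invariant_monic : P \is monic.
Proof.
by rewrite monicE lead_coefDl ?lead_coefXn // size_polyXn size_tail.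
Qed.

Lemma basic_invariant_size : size P = n.+1.
Proof. by rewrite size_polyDl size_polyXn // size_tail. Qed.

Variable act : 'S_n -> {rmorphism S -> S}.
Hypothesis actC : forall s c, act s c%:MP = c%:MP.
Hypothesis actx : forall s a, act s (x a) = x (s^-1%g a).

Let basicT (A : {poly {mpoly R[m.+1]}}) := (map_poly basic_invariant A).[x ord_max].

(** Comparing coefficients in prod_a (T - x_a) = (T - x_last) * prod_(a < n-1) (T - x_a)
    yields those of the second factor one after the other, from the top degree down,
    as polynomials in x_last over the ring generated by e_2, ..., e_n. *)
Lemma coef_prod_widen k : exists A,
  (\prod_i ('X - (x (w i))%:P))`_k = basicT A.
Proof.
pose Q := \prod_i ('X - (x (w i))%:P).
have PQ : map_poly basic_invariant P = Q * ('X - (x ord_max)%:P).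
  by rewrite basic_invariant_poly big_ord_recr.
have size_Q : size Q = n by rewrite size_prod_XsubC -[index_enum _]enumT size_enum_ord.
suff low j : exists A, Q`_(n - j) = basicT A.
  have [le_kn|lt_nk] := leqP k n; first by rewrite -(subKn le_kn); apply: low.
  by exists 0; rewrite nth_default ?size_Q 1?ltnW // /basicT rmorph0 horner0.
elim: j => [|j [A QA]].
  by exists 0; rewrite subn0 nth_default ?size_Q // /basicT rmorph0 horner0.
have [le_nj|lt_jn] := leqP n j.
  by exists A; rewrite -QA; congr (_`_ _); lia.
exists ((P`_(n - j))%:P + 'X * A).
rewrite /basicT rmorphD rmorphM /= map_polyC map_polyX !hornerE -/(basicT A) -QA.
rewrite -coef_map PQ mulrBr coefB coefMX coefMC /= -/Q.
have -> : (n - j == 0)%N = false by lia.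
have -> : (n - j).-1 = (n - j.+1)%N by lia.
by ring.
Qed.

Lemma symmetric_basicT F : F \is symmetric ->
  exists A, F \mPo [tuple x (w i) | i < m.+1] = basicT A.
Proof.
move=> /sym_fundamental [h [<- _]].
rewrite comp_mpoly_comp.
elim/mpoly_ring_ind: h => [c|i|p q [A EA] [B EB]|p q [A EA] [B EB]].
- exists (c%:MP)%:P; rewrite comp_mpolyC /basicT map_polyC hornerC /=.
  by rewrite [basic_invariant _]comp_mpolyC.
- rewrite comp_mpolyU comp_mesym.
  have [A coefA] := coef_prod_widen (m.+1 - i.+1).
  have coefE : (\prod_i ('X - (x (w i))%:P))`_(m.+1 - i.+1)
      = (-1) ^+ i.+1 * elemsym (fun i => x (w i)) i.+1.
    rewrite prod_XsubC_elemsym coef_sum (bigD1 (lift ord0 i)) //= big1 => [|l ne].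
      by rewrite coefCM coefXn eqxx mulr1 addr0.
    rewrite coefCM coefXn; case: eqP => [E|]; last by rewrite mulr0.
    case/eqP: ne; apply: ord_inj; rewrite lift0.
    by have ltl := ltn_ord l; have lti := ltn_ord i; lia.
  exists ((-1) ^+ i.+1 * A); rewrite /basicT rmorphM hornerM -/(basicT A) -coefA coefE.
  rewrite rmorphXn rmorphN1 -[X in X ^+ _]polyCN -polyC_exp hornerC.
  by rewrite mulrA -expr2 sqrr_sign mul1r.
- by exists (A + B); rewrite rmorphD /= EA EB /basicT rmorphD hornerD.
by exists (A * B); rewrite rmorphM /= EA EB /basicT rmorphM hornerM.
Qed.

Lemma basic_invariant_act s h : act s (basic_invariant h) = basic_invariant h.
Proof.
elim/mpoly_ring_ind: h => [c|i|p q IHp IHq|p q IHp IHq].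
- by rewrite [basic_invariant _]comp_mpolyC actC.
- rewrite basic_invariantX rmorph_elemsym /=.
  rewrite -[RHS](elemsym_perm x s^-1%g).
  by apply: eq_elemsym => b; rewrite actx.
- by rewrite !rmorphD /= IHp IHq.
- by rewrite !rmorphM /= IHp IHq.
Qed.

Lemma basic_invariant_surj f : (forall s, act s f = f) ->
  exists h, basic_invariant h = f.
Proof.
move=> inv_f.
pose F := f \mPo [tuple t j | j < m.+1].
have fF : f = F \mPo [tuple x (w i) | i < m.+1].
  rewrite comp_mpoly_comp (eq_comp_mpoly f t_x).
  by rewrite comp_mpoly_id.
have actF s G : act s (G \mPo [tuple x (w i) | i < m.+1])
    = G \mPo [tuple x (s^-1%g (w i)) | i < m.+1].
  elim/mpoly_ring_ind: G => [c|i|p q IHp IHq|p q IHp IHq].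
  - by rewrite !comp_mpolyC actC.
  - by rewrite !comp_mpolyU actx.
  - by rewrite !rmorphD /= IHp IHq.
  - by rewrite !rmorphM /= IHp IHq.
have symF : F \is symmetric.
  apply/issymP => s.
  have E : msym s F \mPo [tuple x (w i) | i < m.+1] = f.
    rewrite msym_mPo -[RHS](inv_f (lift_perm ord_max ord_max s)^-1%g) fF actF invgK.
    apply: eq_comp_mpoly => i.
    by rewrite tnth_mktuple !widen_lift lift_perm_lift.
  have := congr1 (comp_mpoly [tuple t j | j < m.+1]) E.
  by rewrite comp_mpoly_comp (eq_comp_mpoly _ x_t) comp_mpoly_id.
have [A fA] := symmetric_basicT symF.
apply: (root_descent (j := map_mpoly iota) (P := P) (A := A) (x := x)) => //.
- exact: map_mpoly_inj.
- exact: sum_zero_inj.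
- exact: basic_invariant_monic.
- by rewrite basic_invariant_size card_ord ltnSn.
- move=> a; rewrite basic_invariant_poly (bigD1 a) //= rootE hornerM.
  by rewrite hornerXsubC subrr mul0r eqxx.
move=> a; rewrite -[RHS](inv_f (tperm ord_max a)) [in RHS]fF fA /basicT.
rewrite -horner_map /= actx tpermV tpermL -map_poly_comp.
by congr (_.[_]); apply: eq_map_poly => h /=; rewrite basic_invariant_act.
Qed.

End SumZeroCoordinates.

(** * Algebraic independence, and polynomial rings of invariants *)

Lemma mul_subM (A : comNzRingType) (a b a' b' : A) :
  a * b - a' * b' = a * (b - b') + (a - a') * b'.
Proof. by ring. Qed.

(** H is the polynomial h in e_2, ..., e_n in n independent variables, and rho sets the
    last variable to minus the sum of the others. As rho kills H, H is a multiple of the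
    sum s1 of the variables. *)
Lemma elemsym_sum_zero_indep (K : idomainType) (m : nat)
    (y : 'I_m.+2 -> {mpoly K[m.+1]}) (h : {mpoly K[m.+1]}) :
  (forall i, y (widen_ord (leqnSn m.+1) i) = 'X_i) -> \sum_a y a = 0 ->
  h \mPo [tuple elemsym y k.+2 | k < m.+1] = 0 -> h = 0.
Proof.
set w := widen_ord _ => y_w sum_y h0.
pose n := m.+2; pose s1 : {mpoly K[n]} := mesym n K 1.
pose H := h \mPo [tuple mesym n K k.+2 | k < m.+1].
pose rho (F : {mpoly K[n]}) : {mpoly K[n]} :=
  (F \mPo [tuple y a | a < n]) \mPo [tuple 'X_(w i) | i < m.+1].
have rhoX i : rho 'X_(w i) = 'X_(w i) by rewrite /rho comp_mpolyU y_w comp_mpolyU.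
have rho_max : rho 'X_ord_max = - \sum_i 'X_(w i).
  rewrite /rho comp_mpolyU.
  have -> : y ord_max = - \sum_i 'X_i.
    apply/eqP; rewrite -addr_eq0 addrC -(eq_bigr _ (fun i _ => y_w i)).
    by rewrite -(big_ord_recr _ y) /= sum_y.
  rewrite rmorphN rmorph_sum; congr (- _).
  by apply: eq_bigr => i _; rewrite /= comp_mpolyU.
have div_s1 F : exists q, F - rho F = s1 * q.
  elim/mpoly_ring_ind: F => [c|i|p q [P EP] [Q EQ]|p q [P EP] [Q EQ]].
  - by exists 0; rewrite /rho !comp_mpolyC subrr mulr0.
  - case: (unliftP ord_max i) => [j|] ->.
      by exists 0; rewrite -widen_lift rhoX subrr mulr0.
    by exists 1; rewrite rho_max opprK mulr1 [LHS]addrC /s1 mesym1E [RHS]big_ord_recr.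
  - by exists (P + Q); rewrite mulrDr -EP -EQ {1}/rho !rmorphD /= opprD addrACA.
  exists (p * Q + P * rho q); rewrite mulrDr mulrCA -EQ mulrA -EP.
  by rewrite [rho (p * q)](_ : _ = rho p * rho q) ?mul_subM // /rho !rmorphM.
have [q Hq] := div_s1 H.
have {}Hq : H = s1 * q.
  have H0 : H \mPo [tuple y a | a < n] = 0.
    rewrite /H comp_mpoly_comp -[RHS]h0; apply: eq_comp_mpoly => k.
    by rewrite comp_mesym.
  by rewrite -Hq /rho H0 comp_mpoly0 subr0.
have s1_neq0 : s1 != 0 by apply: mesym_neq0.
have symH : H \is symmetric.
  by apply: mcomp_sym => k; rewrite -tnth_nth tnth_mktuple mesym_sym.
have symq : q \is symmetric.
  apply/issymP => s; apply: (mulfI s1_neq0).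
  rewrite -Hq -(issymP _ symH s) Hq msymM.
  by rewrite (issymP _ (mesym_sym n K 1)).
have [k [kq _]] := sym_fundamental symq.
pose h' := h \mPo [tuple 'X_(lift ord0 k) | k < m.+1] : {mpoly K[n]}.
have : h' = 'X_ord0 * k.
  apply: msym_fundamental_un.
  rewrite rmorphM /= kq comp_mpolyU /= -/s1 -Hq /h' comp_mpoly_comp.
  by apply: eq_comp_mpoly => i; rewrite comp_mpolyU lift0.
(* setting the first variable to 0 undoes the shift of indices and kills 'X_0 * k *)
pose v := [tuple if unlift ord0 i is Some j then 'X_j else 0 | i < n]
  : n.-tuple {mpoly K[m.+1]}.
move/(congr1 (comp_mpoly v)); rewrite rmorphM /= comp_mpolyU unlift_none mul0r.
rewrite comp_mpoly_comp => <-.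
rewrite -[LHS]comp_mpoly_id; apply: eq_comp_mpoly => i.
by rewrite comp_mpolyU liftK.
Qed.

Section BasicInvariants.

Variables (R : comNzRingType) (K : idomainType) (iota : {rmorphism R -> K}).
Hypothesis inj_iota : injective iota.
Variables (m : nat) (x : 'I_m.+2 -> {mpoly R[m.+1]}) (t : 'I_m.+1 -> {mpoly R[m.+1]}).
Hypothesis sum_x : \sum_a x a = 0.
Hypothesis x_t : forall i, x (widen_ord (leqnSn m.+1) i) \mPo [tuple t j | j < m.+1] = 'X_i.

Lemma basic_invariant_inj : injective (basic_invariant x).
Proof.
apply: raddf_inj => h h0.
have : h \mPo [tuple elemsym x k.+2 | k < m.+1] = 0 by [].
move/(congr1 (comp_mpoly [tuple t j | j < m.+1])); rewrite comp_mpoly0 comp_mpoly_comp.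
move/(congr1 (map_mpoly iota)); rewrite rmorph0 map_comp_mpoly => {}h0.
apply: (map_mpoly_inj inj_iota); rewrite rmorph0.
pose y a := map_mpoly iota (x a \mPo [tuple t j | j < m.+1]).
apply: (@elemsym_sum_zero_indep _ _ y).
- by move=> i; rewrite /y x_t map_mpolyX.
- by rewrite -rmorph_sum -[\sum_i _]rmorph_sum sum_x !rmorph0.
rewrite -[RHS]h0; apply: eq_comp_mpoly => k.
by rewrite [in RHS](rmorph_elemsym (comp_mpoly _)) rmorph_elemsym.
Qed.

End BasicInvariants.

Section PolynomialRing.

Variables (R : comNzRingType) (n m r : nat).
Variable L : mx_representation int [set: 'S_n] m.
Variable psi : {lrmorphism {mpoly R[r]} -> {mpoly R[m]}}.
Hypothesis psi_inv : forall h, psi h \in invariant_pred L.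

Definition into_invariants (h : {mpoly R[r]}) : invariants R L := Invariant (psi_inv h).

Fact into_invariants_additive : additive into_invariants.
Proof. by move=> p q; apply: val_inj; rewrite /= rmorphB. Qed.
Fact into_invariants_multiplicative : multiplicative into_invariants.
Proof. by split=> [p q|]; apply: val_inj; rewrite /= ?rmorphM ?rmorph1. Qed.
Fact into_invariants_scalable : scalable into_invariants.
Proof. by move=> c p; apply: val_inj; rewrite /= linearZ. Qed.

HB.instance Definition _ :=
  GRing.isAdditive.Build _ _ into_invariants into_invariants_additive.
HB.instance Definition _ :=
  GRing.isMultiplicative.Build _ _ into_invariants into_invariants_multiplicative.
HB.instance Definition _ :=
  GRing.isScalable.Build _ _ _ _ into_invariants into_invariants_scalable.

Lemma is_polynomial_ring_by : injective psi ->
  (forall f, f \in invariant_pred L -> exists h, psi h = f) ->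
  is_polynomial_ring (invariants R L).
Proof.
move=> inj_psi surj_psi; exists r, into_invariants.
have surj (f : invariants R L) : exists h, psi h == f.
  by have [h hf] := surj_psi _ (valP f); exists h; apply/eqP.
exists (fun f => xchoose (surj f)) => [h|f].
  by apply: inj_psi; apply/eqP; apply: (xchooseP (surj (into_invariants h))).
by apply: val_inj; apply/eqP; apply: (xchooseP (surj f)).
Qed.

End PolynomialRing.

(** * Linear forms; the case where n / d is invertible *)

Section LinearForms.

Variable R : comNzRingType.

Definition lform p q (M : 'M[R]_(p, q)) (i : 'I_p) : {mpoly R[q]} :=
  \sum_j M i j *: 'X_j.

Lemma lform_comp p q r (A : 'M[R]_(p, q)) (B : 'M[R]_(q, r)) i :
  lform A i \mPo [tuple lform B j | j < q] = lform (A *m B) i.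
Proof.
rewrite raddf_sum /= /lform.
under eq_bigr => j _ do rewrite comp_mpolyZ comp_mpolyU scaler_sumr.
rewrite exchange_big; apply: eq_bigr => k _ /=.
by rewrite mxE scaler_suml; apply: eq_bigr => j _; rewrite scalerA.
Qed.

Lemma lform1 p i : lform (1%:M : 'M[R]_p) i = 'X_i.
Proof.
rewrite /lform (bigD1 i) //= mxE eqxx scale1r big1 ?addr0 // => j ne.
by rewrite mxE eq_sym (negPf ne) scale0r.
Qed.

Lemma lformZ p q c (M : 'M[R]_(p, q)) i : lform (c *: M) i = c *: lform M i.
Proof. by rewrite /lform scaler_sumr; apply: eq_bigr => j _; rewrite mxE scalerA. Qed.

Lemma lform_coef p q (M : 'M[R]_(p, q)) i j : (lform M i)@_U_(j) = M i j.
Proof.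
rewrite raddf_sum (bigD1 j) //= mcoeffZ mcoeffXU eqxx mulr1 big1 ?addr0 // => k ne.
by rewrite mcoeffZ mcoeffXU (negPf ne) mulr0.
Qed.

Lemma poly_actE n m (L : mx_representation int [set: 'S_n] m) s (f : {mpoly R[m]}) :
  poly_act L s f = f \mPo [tuple lform (map_mx intr (L s^-1%g)) i | i < m].
Proof.
by congr (_ \mPo _); apply: eq_mktuple => i; apply: eq_bigr => j _; rewrite mxE.
Qed.

Lemma poly_act_lform n m (L : mx_representation int [set: 'S_n] m) s p
    (A : 'M[int]_(p, m)) i :
  poly_act L s (lform (map_mx intr A) i) = lform (map_mx intr (A *m L s^-1%g)) i.
Proof. by rewrite poly_actE lform_comp map_mxM. Qed.

Lemma poly_actC n m (L : mx_representation int [set: 'S_n] m) s c :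
  poly_act L s c%:MP = c%:MP_[m] :> {mpoly R[m]}.
Proof. exact: comp_mpolyC. Qed.

Lemma poly_actM n m (L : mx_representation int [set: 'S_n] m) s t (f : {mpoly R[m]}) :
  poly_act L s (poly_act L t f) = poly_act L (s * t)%g f.
Proof.
rewrite (poly_actE L t) poly_actE comp_mpoly_comp poly_actE; apply: eq_comp_mpoly => i.
by rewrite lform_comp -map_mxM -repr_mxM ?inE // invMg.
Qed.

Lemma invariantP n m (L : mx_representation int [set: 'S_n] m) (f : {mpoly R[m]}) :
  reflect (forall s, poly_act L s f = f) (f \in invariant_pred L).
Proof. exact: 'forall_eqP. Qed.

End LinearForms.

Lemma map_poly_act (R K : comNzRingType) (phi : {rmorphism R -> K}) n m
    (L : mx_representation int [set: 'S_n] m) s (f : {mpoly R[m]}) :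
  map_mpoly phi (poly_act L s f) = poly_act L s (map_mpoly phi f).
Proof.
rewrite !poly_actE map_comp_mpoly; apply: eq_comp_mpoly => i.
rewrite rmorph_sum; apply: eq_bigr => j _.
by rewrite /= map_mpolyZ map_mpolyX !mxE rmorph_int.
Qed.

Lemma coord_mx_sum m e (j : 'I_m.+1) : \sum_a coord_mx m e a j = 0.
Proof.
have ltj := ltn_ord j.
under eq_bigr => a _ do rewrite mxE.
rewrite -mulr_sumr; apply/eqP; rewrite mulf_eq0; apply/orP; right; apply/eqP.
rewrite big_ord_recr /= /coord_entry eqxx mul1n.
have -> : (m.+1 + j < m.+1)%N = false by lia.
rewrite (eq_bigr (fun a : 'I_m.+1 => (a < m.+1 - j)%N%:Z)); last first.
  move=> a _; have lta := ltn_ord a.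
  by rewrite /= (ltn_eqF lta) mul0n subr0; congr ((_ : bool) : nat)%:Z; lia.
rewrite -(big_morph Posz PoszD (erefl _)) sub0r.
apply/eqP; rewrite subr_eq0; apply/eqP; congr Posz.
transitivity (\sum_(a < m.+1 | (a < m.+1 - j)%N) 1)%N.
  by rewrite [RHS]big_mkcond; apply: eq_bigr => a _; case: ifP.
by rewrite -(big_ord_widen m.+1 (fun=> 1%N)) ?leq_subr // sum1_card card_ord.
Qed.

(** With r the inverse of e, these are the forms x_a. The matrix B expresses the variables
    by the first n - 1 of them: the first variable is e x_(n-1), the others are the
    differences of two consecutive forms. *)
Section CraigCoordinates.

Variables (m e : nat).

Local Notation w := (widen_ord (leqnSn m.+1)).

Variables (R : comNzRingType) (r : R).
Hypothesis r_inv : r * e%:R = 1.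

Definition craig_coord a : {mpoly R[m.+1]} := lform (r *: map_mx intr (coord_mx m e)) a.

Lemma craig_coord_sum : \sum_a craig_coord a = 0.
Proof.
rewrite exchange_big big1 // => j _ /=; rewrite -scaler_suml.
under eq_bigr => a _ do rewrite [_ a j]mxE [map_mx _ _ _ _]mxE.
rewrite -mulr_sumr -rmorph_sum /= coord_mx_sum mulr0 scale0r //.
Qed.

Let A : 'M[R]_m.+1 := \matrix_(i, j) (r * (coord_mx m e (w i) j)%:~R).
Let B : 'M[R]_m.+1 := \matrix_j
  (if j == 0 then e%:R *: delta_mx 0 ord_max
   else delta_mx 0 (inord (m - j)) - delta_mx 0 (inord (m.+1 - j))).

Let BA : B *m A = 1%:M.
Proof.
apply/row_matrixP => j; rewrite row_mul rowK; have ltj := ltn_ord j.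
case: (eqVneq j 0) => [->|j_neq0].
  rewrite -scalemxAl -rowE; apply/rowP => l; have ltl := ltn_ord l.
  rewrite !mxE /coord_entry /=.
  have -> : (m + l < m.+1)%N = (l == 0) by rewrite -(inj_eq val_inj) /=; lia.
  have -> : (m == m.+1)%N = false by lia.
  rewrite mul0n subr0 (eq_sym 0 l); case: (l == 0); last by rewrite /= mulr0 !mulr0.
  by rewrite mul1r [_%:~R](_ : _ = 1) // mulr1 mulrC.
rewrite mulmxBl -!rowE; apply/rowP => l; have ltl := ltn_ord l; rewrite !mxE /coord_entry /=.
have j_gt0 : (0 < j)%N by rewrite lt0n.
rewrite !inordK; [|lia..].
have -> : (m - j == m.+1)%N = false by lia.
have -> : (m.+1 - j == m.+1)%N = false by lia.
have -> : (m - j + l < m.+1)%N = (l <= j)%N by lia.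
have -> : (m.+1 - j + l < m.+1)%N = (l < j)%N by lia.
rewrite !mul0n !subr0; case: (eqVneq l 0) => [->|_].
  by rewrite leq0n j_gt0 subrr (negPf j_neq0).
rewrite !rmorphM /= -!pmulrn -!mulrBr mulrA r_inv mul1r -(inj_eq val_inj) /=.
by rewrite (eq_sym (j : nat)); case: (ltngtP l j) => _; rewrite ?subrr ?subr0.
Qed.

Lemma craig_coordE i : craig_coord (w i) = lform A i.
Proof. by apply: eq_bigr => j _; rewrite !mxE. Qed.

Variable iota : {rmorphism R -> rat}.
Hypothesis inj_iota : injective iota.

Let t_x j : lform B j \mPo [tuple craig_coord (w i) | i < m.+1] = 'X_j.
Proof. by rewrite (eq_comp_mpoly _ craig_coordE) lform_comp BA lform1. Qed.

Let x_t i : craig_coord (w i) \mPo [tuple lform B j | j < m.+1] = 'X_i.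
Proof. by rewrite craig_coordE lform_comp (mulmx1C BA) lform1. Qed.

Lemma craig_basic_inj : injective (basic_invariant craig_coord).
Proof. exact: (basic_invariant_inj inj_iota craig_coord_sum x_t). Qed.

Variable d : nat.
Hypothesis d_gt0 : (0 < d)%N.
Hypothesis nE : m.+2 = (e * d)%N.
Variable L : mx_representation int [set: 'S_m.+2] m.+1.
Hypothesis craigL : is_craig_rep d L.

Lemma craig_coord_act s a : poly_act L s (craig_coord a) = craig_coord (s^-1%g a).
Proof.
rewrite /craig_coord !lformZ linearZ /= poly_act_lform (coord_mx_act d_gt0 nE craigL).
by congr (_ *: _); apply: eq_bigr => j _; rewrite !mxE.
Qed.

Lemma craig_basic_surj f : (0 < m)%N -> f \in invariant_pred L ->
  exists h, basic_invariant craig_coord h = f.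
Proof.
move=> m_gt0 /invariantP; apply: (basic_invariant_surj inj_iota m_gt0 craig_coord_sum t_x x_t).
  exact: poly_actC.
exact: craig_coord_act.
Qed.

Lemma craig_basic_inv h : basic_invariant craig_coord h \in invariant_pred L.
Proof.
apply/invariantP => s.
exact: (basic_invariant_act (act := poly_act L) (poly_actC L) craig_coord_act).
Qed.

Lemma craig_is_polynomial : (0 < m)%N -> is_polynomial_ring (invariants R L).
Proof.
move=> m_gt0; apply: (is_polynomial_ring_by (psi := basic_invariant craig_coord)).
- exact: craig_basic_inv.
- exact: craig_basic_inj.
by move=> f; apply: craig_basic_surj.
Qed.

End CraigCoordinates.

(** * Lifting invariants modulo a prime from a polynomial ring of invariants *)

(** If all powers of b / a have the common denominator c, so have those of b / a - s. *)
Lemma dvd_powers_subM (A : comNzRingType) (a b c s : A) :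
  (forall k, exists q, c * b ^+ k = a ^+ k * q) ->
  forall k, exists q, c * (b - a * s) ^+ k = a ^+ k * q.
Proof.
move=> dvd_b k; rewrite exprBn mulr_sumr.
apply: (big_ind (fun z => exists q, z = a ^+ k * q)).
- by exists 0; rewrite mulr0.
- by move=> _ _ [p ->] [q ->]; exists (p + q); rewrite mulrDr.
move=> i _; have [q Eq] := dvd_b (k - i)%N.
exists (((-1) ^+ i * q * s ^+ i) *+ 'C(k, i)).
rewrite !mulrnAr; congr (_ *+ _).
have -> : a ^+ k = a ^+ (k - i) * a ^+ i by rewrite -exprD subnK // -ltnS.
rewrite exprMn.
transitivity ((-1) ^+ i * (c * b ^+ (k - i)) * (a ^+ i * s ^+ i)); first by ring.
by rewrite Eq; ring.
Qed.

Section PowerDivisibility.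

Variables (F : fieldType) (r : nat).
Implicit Types a b c : {mpoly F[r]}.

(** A polynomial ring over a field is completely integrally closed. From
    c * b ^ k = a ^ k * q the leading monomials satisfy
    k * lead(a) <= lead(c) + k * lead(b) for all k, whence lead(a) divides lead(b);
    subtracting a multiple of a from b cancels the leading term of b and preserves the
    hypothesis. *)
Lemma mpoly_almost_integral a b c : a != 0 -> c != 0 ->
  (forall k, exists q, c * b ^+ k = a ^+ k * q) -> exists q, b = a * q.
Proof.
move=> a_neq0 c_neq0; elim/mleadrect: b => b IH almost_int.
have [->|b_neq0] := eqVneq b 0; first by exists 0; rewrite mulr0.
have le_lead : (mlead a <= mlead b)%MM.
  apply/mnm_lepP => i; have [q E] := almost_int (mlead c i).+1.
  have q_neq0 : q != 0.
    apply: contra_eq_neq E => ->; rewrite mulr0 mulf_neq0 // expf_neq0 //.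
  have := congr1 (fun p => mlead p i) E.
  rewrite /= !mleadM ?expf_neq0 // !mleadX // !mnmDE !mulmnE => {}E.
  rewrite leqNgt; apply/negP => lt_ba.
  move: E lt_ba; move: (mlead a i) (mlead b i) (mlead c i) (mlead q i) => A B C Q E lt_BA.
  by have := leq_mul lt_BA (leqnn C.+1); rewrite mulSn; lia.
(* the multiple of a with the same leading term as b *)
pose s := (mleadc b / mleadc a) *: 'X_[mlead b - mlead a] : {mpoly F[r]}.
pose b' := b - a * s.
have [b'0|b'_neq0] := eqVneq b' 0.
  by exists s; apply/eqP; rewrite -subr_eq0; apply/eqP.
have lc_neq0 : mleadc a != 0 by rewrite mleadc_eq0.
have s_neq0 : s != 0.
  by rewrite -mleadc_eq0 mleadcZE !mulf_neq0 ?invr_eq0 ?mleadc_eq0 //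
    -msize_poly_eq0 msizeX.
have lead_as : mlead (a * s) = mlead b.
  rewrite mleadM // mleadZ ?mleadXm ?mulf_neq0 ?invr_eq0 ?mleadc_eq0 //.
  by rewrite addmC submK.
have lead_b' : (mlead b' < mlead b)%O.
  rewrite Order.POrderTheory.lt_neqAle; apply/andP; split; last first.
    by have := mleadB_le b (a * s); rewrite lead_as Order.JoinTheory.joinxx.
  apply: contraNneq b'_neq0 => E; rewrite -mleadc_eq0 E mcoeffB.
  rewrite -[in X in _ - X]lead_as mleadM // mleadcM mleadcZE mleadXm mcoeffX eqxx.
  by rewrite mulr1 mulrC divfK // subrr.
have [|q bq] := IH b' lead_b'; last by exists (q + s); rewrite mulrDr -bq subrK.
exact: dvd_powers_subM.
Qed.

(** The powers of b / a have the common denominator a ^ M, because the M-th power of b / a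
    is the polynomial v. *)
Lemma mpoly_root_closed a b v M : a != 0 -> (0 < M)%N -> a ^+ M * v = b ^+ M ->
  exists q, b = a * q.
Proof.
move=> a_neq0 M_gt0 E.
apply: (mpoly_almost_integral (c := a ^+ M)) => // [|k]; first exact: expf_neq0.
have lt_mod := ltn_pmod k M_gt0.
exists (a ^+ (M - k %% M) * v ^+ (k %/ M) * b ^+ (k %% M)).
transitivity (a ^+ M * (a ^+ M * v) ^+ (k %/ M) * b ^+ (k %% M)).
  by rewrite E -exprM -mulrA -exprD mulnC -divn_eq.
transitivity (a ^+ (k + (M - k %% M)) * v ^+ (k %/ M) * b ^+ (k %% M)).
  have -> : (k + (M - k %% M) = M + M * (k %/ M))%N.
    by rewrite {1}(divn_eq k M) -addnA subnKC 1?ltnW // mulnC addnC.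
  by rewrite exprMn -exprM exprD; ring.
by rewrite exprD; ring.
Qed.

End PowerDivisibility.

(** Dedekind's independence of distinct endomorphisms of a domain. In a shortest
    vanishing combination, replacing y by x y and subtracting g_i(x) times the
    combination removes the term i but not the term j, if g_i(x) != g_j(x). *)
Lemma rmorphism_sum_neq0 (T : idomainType) (I : finType) (g : I -> {rmorphism T -> T})
    (i0 : I) : (forall i j, i != j -> exists x, g i x != g j x) ->
  exists y, \sum_i g i y != 0.
Proof.
move=> distinct.
suff ded k (J : {set I}) c : (#|J| <= k)%N -> J != set0 -> (forall i, i \in J -> c i != 0) ->
    exists y, \sum_(i in J) c i * g i y != 0.
  have [||y Hy] := ded _ [set: I] (fun=> 1) (leqnn _).
  - by apply/set0Pn; exists i0; rewrite inE.
  - by move=> i _; apply: oner_neq0.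
  exists y; apply: contraNneq Hy => sum0; rewrite -[X in _ == X]sum0.
  by apply/eqP; apply: eq_big => [i|i _]; rewrite ?inE ?mul1r.
elim: k J c => [|k IH] J c.
  by rewrite leqn0 cards_eq0 => ->.
move=> le_Jk /set0Pn [i Ji] c_neq0.
have [j /andP [/= Jj ne_ij]|J1] := pickP [pred j in J | j != i]; last first.
  exists 1; rewrite (bigD1 i) //= big1 ?addr0 => [|l /andP [Jl ne]].
    by rewrite rmorph1 mulr1 c_neq0.
  by have := J1 l; rewrite /= Jl ne.
have [x gx] := distinct _ _ ne_ij.
pose J' := [set l in J | g l x != g i x].
have [|||y Hy] := IH J' (fun l => c l * (g l x - g i x)).
- rewrite -ltnS (leq_trans _ le_Jk) // proper_card //; apply/properP; split.
    by apply/subsetP => l; rewrite inE => /andP [].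
  by exists i => //; rewrite inE eqxx andbF.
- by apply/set0Pn; exists j; rewrite inE Jj.
- by move=> l; rewrite inE => /andP [Jl ne]; rewrite mulf_neq0 ?c_neq0 // subr_eq0.
have [/eqP y0|] := boolP (\sum_(l in J) c l * g l y == 0); last by exists y.
exists (x * y); apply: contraNneq Hy => xy0.
apply/eqP; transitivity
  (\sum_(l in J) c l * g l (x * y) - g i x * \sum_(l in J) c l * g l y); last first.
  by rewrite xy0 y0 mulr0 subr0.
rewrite mulr_sumr -sumrB [RHS](bigID [pred l | g l x != g i x]) /=.
rewrite [X in _ = _ + X]big1 ?addr0 => [|l /andP [_ /negPn /eqP El]]; last first.
  by rewrite rmorphM El; ring.
apply: eq_big => [l|l _]; first by rewrite inE.
by rewrite rmorphM; ring.
Qed.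

Section Obstruction.

Variables (R : comNzRingType) (F : fieldType) (red : {rmorphism R -> F}) (pi : R).
Hypothesis red_surj : forall c, exists a, red a = c.
Hypothesis red_pi : red pi = 0.
Hypothesis red_ker : forall a, red a = 0 -> exists b, a = pi * b.
Hypothesis pi_reg : forall a, pi * a = 0 -> a = 0.

Local Notation redm := (map_mpoly red).

Lemma map_mpoly_surj k (q : {mpoly F[k]}) : exists p, redm p = q.
Proof.
elim/mpoly_ring_ind: q => [c|i|p q [p' <-] [q' <-]|p q [p' <-] [q' <-]].
- by have [a <-] := red_surj c; exists a%:MP; rewrite map_mpolyC.
- by exists 'X_i; rewrite map_mpolyX.
- by exists (p' + q'); rewrite rmorphD.
by exists (p' * q'); rewrite rmorphM.
Qed.

Lemma map_mpoly_ker k (p : {mpoly R[k]}) : redm p = 0 -> exists q, p = pi *: q.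
Proof.
move=> p0; rewrite [p]mpolyE.
apply: (big_ind (fun z => exists q, z = pi *: q)).
- by exists 0; rewrite scaler0.
- by move=> _ _ [a ->] [b ->]; exists (a + b); rewrite scalerDr.
move=> l _; have [|b ->] := red_ker (a := p@_l); last by exists (b *: 'X_[l]); rewrite scalerA.
by rewrite -mcoeff_map_mpoly p0 mcoeff0.
Qed.

Lemma map_mpoly_pi k (p : {mpoly R[k]}) : redm (pi *: p) = 0.
Proof. by rewrite map_mpolyZ red_pi scale0r. Qed.

Lemma mpoly_pi_reg k : injective (fun p : {mpoly R[k]} => pi *: p).
Proof.
move=> p q E; apply/mpolyP => l; apply/eqP; rewrite -subr_eq0; apply/eqP.
by apply: pi_reg; rewrite mulrBr -!mcoeffZ E subrr.
Qed.

Variables (n m : nat) (L : mx_representation int [set: 'S_n] m).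

Hypothesis faithful :
  forall s t : 'S_n, s != t -> exists f : {mpoly F[m]}, poly_act L s f != poly_act L t f.

(** With B the ring of invariants, a = sum_s s(y) and b = sum_s s(g y) lie in B and satisfy
    b = g a modulo pi, while the product v of the conjugates of g satisfies v = g ^ M modulo
    pi. Since B is saturated, its reduction is again a polynomial ring, and there
    [mpoly_root_closed] makes b a multiple of a. *)
Lemma lift_invariant (g : {mpoly R[m]}) :
  (forall s, redm (poly_act L s g) = redm g) -> is_polynomial_ring (invariants R L) ->
  exists2 f, f \in invariant_pred L & redm f = redm g.
Proof.
move=> g_inv [r [phi bij_phi]].
have [phi' phiK phi'K] := bij_phi.
pose psi h : {mpoly R[m]} := \val (phi h).
have psi_inv h : psi h \in invariant_pred L by apply: valP.
have psi_surj f : f \in invariant_pred L -> exists h, psi h = f.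
  by move=> f_inv; exists (phi' (Invariant f_inv)); rewrite /psi phi'K.
have psiB p q : psi (p - q) = psi p - psi q by rewrite /psi !rmorphB.
have psiM p q : psi (p * q) = psi p * psi q by rewrite /psi !rmorphM.
have psiX p k : psi (p ^+ k) = psi p ^+ k by rewrite /psi !rmorphXn.
have psiZ c p : psi (c *: p) = c *: psi p by rewrite /psi !linearZ.
(* both reductions vanish together: an invariant divisible by pi is pi times an
   invariant *)
have red_psi p : redm p = 0 <-> redm (psi p) = 0.
  split=> [/map_mpoly_ker [q ->]|/map_mpoly_ker [q pq]].
    by rewrite psiZ map_mpoly_pi.
  have q_inv : q \in invariant_pred L.
    apply/invariantP => s; apply: mpoly_pi_reg.
    by have := invariantP _ _ (psi_inv p) s; rewrite pq linearZ.
  have [q' q'q] := psi_surj _ q_inv.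
  have -> : p = pi *: q'; last exact: map_mpoly_pi.
  by apply: (can_inj phiK); apply: val_inj; apply: etrans pq _; rewrite -q'q -psiZ.
pose Tr (f : {mpoly R[m]}) := \sum_s poly_act L s f.
have Tr_inv f : Tr f \in invariant_pred L.
  apply/invariantP => s; rewrite rmorph_sum [RHS](reindex_inj (mulgI s)).
  by apply: eq_bigr => t _; rewrite /= poly_actM.
have N_inv : \prod_s poly_act L s g \in invariant_pred L.
  apply/invariantP => s; rewrite rmorph_prod [RHS](reindex_inj (mulgI s)).
  by apply: eq_bigr => t _; rewrite /= poly_actM.
have [y Ty] : exists y, redm (Tr y) != 0.
  have [y' Hy'] := rmorphism_sum_neq0
    (g := fun s => poly_act L s : {rmorphism {mpoly F[m]} -> _}) 1%g faithful.
  have [y yy'] := map_mpoly_surj y'; exists y; rewrite rmorph_sum.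
  by rewrite (eq_bigr (fun s => poly_act L s y')) // => s _; rewrite /= map_poly_act yy'.
have [a aE] := psi_surj _ (Tr_inv y).
have [b bE] := psi_surj _ (Tr_inv (g * y)).
have [v vE] := psi_surj _ N_inv.
have red_b : redm (psi b) = redm g * redm (psi a).
  rewrite aE bE !rmorph_sum mulr_sumr; apply: eq_bigr => s _.
  by rewrite /= !rmorphM /= g_inv.
pose M := #|'S_n|.
have red_v : redm (psi v) = redm g ^+ M.
  rewrite vE rmorph_prod (eq_bigr (fun=> redm g)) => [|s _]; last exact: g_inv.
  by rewrite prodr_const.
have M_gt0 : (0 < M)%N by apply/card_gt0P; exists 1%g.
have a_neq0 : redm a != 0.
  by apply: contraNneq Ty => /red_psi; rewrite aE => ->.
have E : redm a ^+ M * redm v = redm b ^+ M.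
  rewrite -!rmorphXn -rmorphM; apply/eqP; rewrite -subr_eq0 -rmorphB; apply/eqP.
  apply/red_psi; rewrite psiB psiM !psiX rmorphB rmorphM !rmorphXn /= red_b red_v.
  by rewrite exprMn mulrC subrr.
have [q' Eq'] := mpoly_root_closed a_neq0 M_gt0 E.
have [q qq'] := map_mpoly_surj q'.
exists (psi q) => //.
have : redm (psi (b - a * q)) = 0 by apply/red_psi; rewrite rmorphB rmorphM /= qq' Eq' subrr.
rewrite psiB psiM rmorphB rmorphM /= red_b mulrC -mulrBr => /eqP.
rewrite mulf_eq0 aE (negPf Ty) subr_eq0 => /eqP <- //.
Qed.

End Obstruction.

(** * Linear parts of invariants, and reduction modulo a prime *)

Lemma mcoeffU_mul (R : comNzRingType) k (p q : {mpoly R[k]}) j :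
  (p * q)@_U_(j) = p@_U_(j) * q@_0%MM + p@_0%MM * q@_U_(j).
Proof.
have E (f : {mpoly R[k]}) : f@_U_(j) = (f^`M(j))@_0%MM.
  by rewrite mcoeff_deriv mnm0E mulr1n add0m.
by rewrite !E mderivM mcoeffD !rmorphM.
Qed.

Lemma mcoeffU_comp (R : comNzRingType) k l (x : 'I_k -> {mpoly R[l]}) h j :
  (forall i, (x i)@_U_(j) = 0) -> (h \mPo [tuple x i | i < k])@_U_(j) = 0.
Proof.
move=> x0; elim/mpoly_ring_ind: h => [c|i|p q IHp IHq|p q IHp IHq].
- rewrite comp_mpolyC mcoeffC (_ : (_ == _) = false) ?mulr0 //.
  by apply/eqP => /(congr1 mdeg); rewrite mdeg0 mdeg1.
- by rewrite comp_mpolyU.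
- by rewrite rmorphD mcoeffD IHp IHq addr0.
by rewrite rmorphM /= mcoeffU_mul IHp IHq mulr0 mul0r addr0.
Qed.

Lemma mcoeffU_elemsym (R : comNzRingType) n l (x : 'I_n -> {mpoly R[l]}) k j :
  (forall i, (x i)@_0%MM = 0) -> (elemsym x k.+2)@_U_(j) = 0.
Proof.
move=> x0; rewrite raddf_sum big1 // => h /= /eqP card_h.
have [a ah] : exists a, a \in h by apply/card_gt0P; rewrite card_h.
have [b] : exists b, b \in h :\ a by apply/card_gt0P; rewrite (cardsD1 a h) ah in card_h; lia.
rewrite in_setD1 => /andP [ba bh].
rewrite (bigD1 a) //= mcoeffU_mul (bigD1 b) ?bh //= x0 rmorphM /= x0.
by rewrite !mul0r mulr0 addr0.
Qed.

Lemma lform_coef0 (R : comNzRingType) p q (M : 'M[R]_(p, q)) i : (lform M i)@_0%MM = 0.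
Proof.
rewrite raddf_sum big1 // => j _ /=; rewrite mcoeffZ mcoeffX (_ : (_ == _) = false) ?mulr0 //.
by apply/eqP => /(congr1 mdeg); rewrite mdeg0 mdeg1.
Qed.

Section Reduction.

Variables (R : comNzRingType) (iota : {rmorphism R -> rat}) (p : nat).
Hypothesis inj_iota : injective iota.
Hypothesis p_pr : prime p.
Hypothesis p_ninv : ~ exists r : R, r * p%:R = 1.

(** If p divided the denominator of a, Bezout would turn a into an inverse of p in R. *)
Lemma denq_coprime a : coprime p `|denq (iota a)|.
Proof.
rewrite prime_coprime //; apply/negP => /dvdnP [k dE].
apply: p_ninv.
set q := iota a in dE.
have cop : coprimez (numq q) (denq q) by apply: coprime_num_den.
have [[u v] uv] := coprimezP _ _ cop.
(* with q = N / (k p) and u N + v k p = 1, the inverse of p is k (u q + v) *)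
exists (u%:~R * k%:R * a + v%:~R * k%:R).
apply: inj_iota.
rewrite rmorphM rmorphD !rmorphM !rmorph_int !rmorph_nat rmorph1.
have kp : k%:R * p%:R = (denq q)%:~R :> rat.
  by rewrite -natrM -dE -[in RHS](gez0_abs (denq_ge0 q)) pmulrn.
have dq : (denq q)%:~R * iota a = (numq q)%:~R.
  by rewrite mulrC numqE.
transitivity (u%:~R * ((k%:R * p%:R) * iota a) + v%:~R * (k%:R * p%:R) : rat); first by ring.
by rewrite kp dq -!rmorphM -rmorphD /= uv.
Qed.

Definition reduce (a : R) : 'F_p := (numq (iota a))%:~R / (denq (iota a))%:~R.

Lemma intr_Fp_eq0 (z : int) : ((z%:~R : 'F_p) == 0) = (p %| `|z|)%N.
Proof.
case: z => k; last rewrite NegzE mulrNz oppr_eq0 abszN.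
all: by rewrite -pmulrn -(dvdn_pcharf (pchar_Fp p_pr)).
Qed.

Lemma reduceE (a : R) (x y : int) : ~~ (p %| `|y|)%N -> iota a * y%:~R = x%:~R ->
  reduce a = x%:~R / y%:~R.
Proof.
move=> y_ndiv E; set q := iota a in E.
have d_ndiv : ~~ (p %| `|denq q|)%N by rewrite -prime_coprime // denq_coprime.
rewrite /reduce -/q; apply/eqP; rewrite eqr_div ?intr_Fp_eq0 // -!rmorphM /=.
suff -> : numq q * y = x * denq q by [].
apply: (@intr_inj rat); rewrite !rmorphM /= -E numqE -/q.
by rewrite mulrAC.
Qed.

Let frac (a : R) : exists x y : int,
  [/\ ~~ (p %| `|y|)%N, iota a * y%:~R = x%:~R & reduce a = x%:~R / y%:~R].
Proof.
exists (numq (iota a)), (denq (iota a)); split => //.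
  by rewrite -prime_coprime // denq_coprime.
by rewrite numqE.
Qed.

Fact reduce_additive : additive reduce.
Proof.
move=> a b; have [x [y [Hy Ea ->]]] := frac a; have [z [t [Ht Eb ->]]] := frac b.
rewrite (@reduceE _ (x * t - z * y) (y * t)).
- rewrite rmorphB !rmorphM /=; field.
  by rewrite !intr_Fp_eq0 Hy Ht.
- by rewrite abszM Euclid_dvdM // negb_or Hy.
by rewrite rmorphB !rmorphM rmorphB !rmorphM /= -Ea -Eb; ring.
Qed.

Fact reduce_multiplicative : multiplicative reduce.
Proof.
split=> [a b|]; last first.
  rewrite (@reduceE _ 1 1) ?divr1 ?rmorph1 ?mulr1 //.
  by rewrite dvdn1 neq_ltn prime_gt1 ?orbT.
have [x [y [Hy Ea ->]]] := frac a; have [z [t [Ht Eb ->]]] := frac b.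
rewrite (@reduceE _ (x * z) (y * t)).
- rewrite !rmorphM /=; field.
  by rewrite !intr_Fp_eq0 Hy Ht.
- by rewrite abszM Euclid_dvdM // negb_or Hy.
by rewrite !rmorphM /= -Ea -Eb; ring.
Qed.

HB.instance Definition _ := GRing.isAdditive.Build R 'F_p reduce reduce_additive.
HB.instance Definition _ := GRing.isMultiplicative.Build R 'F_p reduce reduce_multiplicative.

Lemma reduction_mod_p : exists red : {rmorphism R -> 'F_p},
  [/\ forall c, exists a, red a = c, red p%:R = 0 &
      forall a, red a = 0 -> exists b, a = p%:R * b].
Proof.
exists reduce; split=> [c||a].
- by exists (c : nat)%:R; rewrite rmorph_nat natr_Zp.
- by rewrite rmorph_nat pchar_Fp_0.
have [x [y [Hy Ea redE]]] := frac a; rewrite [_ a]redE => /eqP.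
rewrite mulf_eq0 invr_eq0 !intr_Fp_eq0 (negPf Hy) orbF => p_x.
have /dvdzP [k xk] : (p%:Z %| x)%Z by [].
have cop : coprimez y p.
  by rewrite /coprimez /gcdz /= eqz_nat -/(coprime _ _) coprime_sym prime_coprime.
have [[u v] uv] := coprimezP _ _ cop.
exists (u%:~R * k%:~R + v%:~R * a).
apply: inj_iota; rewrite rmorphM rmorphD !rmorphM !rmorph_int rmorph_nat.
transitivity (iota a * (u * y + v * p)%:~R); first by rewrite uv mulr1.
rewrite rmorphD !rmorphM /= mulrDr mulrCA Ea xk rmorphM /= -pmulrn; ring.
Qed.

Lemma prime_regular (a : R) : p%:R * a = 0 -> a = 0.
Proof.
move=> /(congr1 iota) /eqP; rewrite rmorphM rmorph_nat rmorph0 mulf_eq0 pnatr_eq0.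
by rewrite (gtn_eqF (prime_gt0 p_pr)) /= => /eqP E; apply: inj_iota; rewrite E rmorph0.
Qed.

End Reduction.

(** * The case where n / d is not invertible *)

Lemma ord_avoid n (s : seq 'I_n) : (size s < n)%N -> exists c, c \notin s.
Proof.
move=> lt_s; have [c /= c_s|all_s] := pickP [predC s]; first by exists c.
have : (#|'I_n| <= size s)%N.
  apply: leq_trans (card_size s); apply: subset_leq_card; apply/subsetP => c _.
  by have := all_s c; rewrite /= => /negbFE.
by rewrite card_ord leqNgt lt_s.
Qed.

Lemma coord_entry_lt m (a : 'I_m.+2) (j : 'I_m.+1) : (a < m.+1)%N ->
  coord_entry a j = (a + j < m.+1)%N%:Z.
Proof. by move=> lt_a; rewrite /coord_entry (ltn_eqF lt_a) mul0n subr0. Qed.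

Lemma coord_entry_last m (j : 'I_m.+1) : coord_entry ord_max j = - (m.+1 - j)%N%:Z.
Proof.
rewrite /coord_entry /= eqxx mul1n (_ : (m.+1 + j < m.+1)%N = false) ?sub0r //.
by apply/negbTE; rewrite -leqNgt leq_addr.
Qed.

Lemma mcoeffU_lift_neq0 (R : comNzRingType) (F : fieldType) (red : {rmorphism R -> F}) k
    (f : {mpoly R[k]}) i :
  map_mpoly red f = map_mpoly red 'X_i -> f@_U_(i) <> 0.
Proof.
move=> /(congr1 (mcoeff U_(i))) fX f0; move: fX.
rewrite map_mpolyX mcoeffXU eqxx mcoeff_map_mpoly f0 raddf0 => /eqP.
by rewrite eq_sym oner_eq0.
Qed.

Section OnlyIf.

Variables (m e d : nat).
Hypothesis d_gt0 : (0 < d)%N.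
Hypothesis nE : m.+2 = (e * d)%N.
Variable L : mx_representation int [set: 'S_m.+2] m.+1.
Hypothesis craigL : is_craig_rep d L.

Local Notation n := m.+2.

(** The difference of two rows is the integral form x_a - x_b. *)
Definition root_mx : 'M[int]_(n, m.+1) :=
  \matrix_(a, j) (if j == 0 then - (d * (a == ord_max))%N%:Z else coord_entry a j).

Lemma root_mxE a b j :
  e%:Z * (root_mx a j - root_mx b j) = coord_mx m e a j - coord_mx m e b j.
Proof.
rewrite !mxE; case: (eqVneq j 0) => [->|_]; last by rewrite mulrBr.
have entry0 c : coord_entry c (0 : 'I_m.+1) = 1 - e%:Z * (d * (c == ord_max))%N%:Z.
  case: (unliftP ord_max c) => [c'|] ->.
    rewrite coord_entry_lt lift_max // addn0 ltn_ord.
    by rewrite eq_sym (negPf (neq_lift _ _)) muln0 mulr0 subr0.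
  by rewrite coord_entry_last eqxx muln1 subn0 -PoszM -nE; lia.
by rewrite !mul1r !entry0; ring.
Qed.

Lemma root_act (R : comNzRingType) s a b :
  poly_act L s (lform (map_mx intr root_mx) a - lform (map_mx intr root_mx) b)
    = lform (map_mx intr root_mx) (s^-1%g a) - lform (map_mx intr root_mx) (s^-1%g b)
    :> {mpoly R[m.+1]}.
Proof.
have e_neq0 : e%:Z != 0 by apply/eqP; lia.
have act j : (root_mx *m L s^-1%g) a j - (root_mx *m L s^-1%g) b j
    = root_mx (s^-1%g a) j - root_mx (s^-1%g b) j.
  apply: (mulfI e_neq0); rewrite root_mxE.
  have Z_act c : coord_mx m e (s^-1%g c) j = (coord_mx m e *m L s^-1%g) c j.
    by rewrite (coord_mx_act d_gt0 nE craigL) [in RHS]mxE.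
  rewrite !Z_act !(mxE _ _ _ j) -sumrB -[in RHS]sumrB mulr_sumr; apply: eq_bigr => k _.
  by rewrite -!mulrBl mulrA root_mxE.
rewrite rmorphB /= !poly_act_lform /lform -!sumrB; apply: eq_bigr => j _.
by rewrite -!scalerBl !(mxE map_mx_key) -!rmorphB /= -act.
Qed.

Section Field.

Variable F : fieldType.
Hypothesis e0 : e%:R = 0 :> F.

(** When e vanishes in F, all the forms e x_a reduce to the first variable. *)
Lemma coord_mod a : lform (map_mx intr (coord_mx m e)) a = 'X_0 :> {mpoly F[m.+1]}.
Proof.
rewrite -[RHS]lform1; apply: eq_bigr => j _; congr (_ *: _); rewrite !mxE eq_sym.
case: (eqVneq j 0) => [->|_]; last by rewrite rmorphM /= -pmulrn e0 mul0r.
rewrite mul1r; case: (unliftP ord_max a) => [c|] ->.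
  by rewrite coord_entry_lt lift_max // addn0 ltn_ord.
rewrite coord_entry_last subn0 rmorphN /= -pmulrn.
apply/eqP; rewrite eq_sym -addr_eq0 nat1r nE natrM e0 mul0r //.
Qed.

Lemma X0_coord (R : comNzRingType) :
  'X_0 = lform (map_mx intr (coord_mx m e)) (lift ord_max ord_max) :> {mpoly R[m.+1]}.
Proof.
rewrite -lform1; apply: eq_bigr => j _; congr (_ *: _); rewrite !mxE eq_sym.
rewrite coord_entry_lt lift_max //=.
case: (eqVneq j 0) => [->|]; first by rewrite addn0 leqnn mulr1.
by rewrite -(inj_eq val_inj) /= => j0; rewrite (_ : (m + j < m.+1)%N = false) ?mulr0 //; lia.
Qed.

Lemma X0_act s : poly_act L s 'X_0 = 'X_0 :> {mpoly F[m.+1]}.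
Proof.
rewrite X0_coord poly_act_lform (coord_mx_act d_gt0 nE craigL) coord_mod.
rewrite -(coord_mod (s^-1%g (lift ord_max ord_max))).
by apply: eq_bigr => j _; rewrite !mxE.
Qed.

(** Column j > 0 of [root_mx] equates the sum of the first n - 1 - j coefficients with
    n - 1 - j times the last one, and consecutive columns then give the individual
    coefficients; column 0 contributes d times the last coefficient. *)
Lemma root_kernel (alpha : 'I_n -> F) : \sum_a alpha a = 0 ->
    \sum_a alpha a *: lform (map_mx intr root_mx) a = 0 :> {mpoly F[m.+1]} ->
  (forall a, alpha a = alpha ord_max) /\ d%:R * alpha ord_max = 0.
Proof.
move=> sum0 lin0.
have col0 j : \sum_a alpha a * (root_mx a j)%:~R = 0.
  have := congr1 (mcoeff U_(j)) lin0; rewrite mcoeff0 raddf_sum /= => E0.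
  by rewrite -[RHS]E0; apply: eq_bigr => a _; rewrite mcoeffZ lform_coef (mxE map_mx_key).
have n0 : n%:R = 0 :> F by rewrite nE natrM e0 mul0r.
pose beta k := alpha (inord k).
have prefix k : (k <= m.+1)%N -> \sum_(0 <= c < k) beta c = k%:R * alpha ord_max.
  have lastE : \sum_(0 <= c < m.+1) beta c = - alpha ord_max.
    apply/eqP; rewrite -addr_eq0 -[X in _ + X](_ : beta m.+1 = _); last first.
      by congr alpha; apply: ord_inj; rewrite inordK.
    rewrite -big_nat_recr //= big_mkord -[X in _ == X]sum0; apply/eqP.
    by apply: eq_bigr => a _; rewrite /beta inord_val.
  have [->|k_gt0] := posnP k; first by rewrite big_geq // mul0r.
  rewrite leq_eqVlt => /orP [/eqP->|lt_k].
    rewrite lastE -mulN1r; congr (_ * _); apply/eqP.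
    by rewrite eq_sym -addr_eq0 natr1 n0.
  have lt_j : (m.+1 - k < m.+1)%N by lia.
  have := col0 (Ordinal lt_j).
  have k0 : (Ordinal lt_j == 0) = false by rewrite -(inj_eq val_inj) /=; lia.
  rewrite big_ord_recr /= mxE k0. 
  have jk : (m.+1 - Ordinal lt_j = k)%N by rewrite /= subKn 1?ltnW.
  rewrite coord_entry_last jk mulrNz mulrN -pmulrn.
  move/eqP; rewrite subr_eq0 mulrC => /eqP <-.
  rewrite big_mkord (big_ord_widen m.+1 (fun c => beta c)) ?(ltnW lt_k) // big_mkcond.
  apply: eq_bigr => c _; rewrite mxE k0 coord_entry_lt /=; last exact: ltn_ord.
  have -> : (c + (m.+1 - k) < m.+1)%N = (c < k)%N by lia.
  case: ifP => _; last by rewrite mulr0.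
  rewrite mulr1 /beta; congr alpha; apply: ord_inj; rewrite inordK //= ltnS ltnW //.
split=> [a|].
  case: (unliftP ord_max a) => [c|] -> //.
  have := prefix c.+1 (ltn_ord c); rewrite big_nat_recr //= prefix 1?ltnW //.
  rewrite -natr1 mulrDl mul1r => /addrI <-.
  by congr alpha; apply: ord_inj; rewrite lift_max inordK // ltnS ltnW.
have := col0 0; rewrite (bigD1 ord_max) //= big1 ?addr0 => [|a ne].
  by rewrite mxE /= eqxx muln1 rmorphN mulrN mulrC => /eqP; rewrite oppr_eq0 => /eqP.
by rewrite mxE /= (negPf ne) muln0 mulr0.
Qed.

(** If s and t act alike, then x_(u a) - x_(u b) = x_(v a) - x_(v b) for all a and b, with u
    and v the inverses of s and t. Choosing a with u a != v a, and b such that u a only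
    occurs once, contradicts [root_kernel]: either d = 1 is nonzero in F, or n > 4 and
    some coordinate occurs in neither difference. *)
Lemma act_faithful : (0 < m)%N -> (2 < m)%N \/ d = 1%N -> forall s t : 'S_n, s != t ->
  exists f : {mpoly F[m.+1]}, poly_act L s f != poly_act L t f.
Proof.
move=> m_gt0 m_d s t ne_st; apply: NNPP => same.
have {}same f : poly_act L s f = poly_act L t f :> {mpoly F[m.+1]}.
  by apply/eqP/negPn/negP => ne; apply: same; exists f.
pose u := s^-1%g; pose v := t^-1%g.
have [a ne_uv] : exists a, u a != v a.
  apply: NNPP => eq_uv; case/eqP: ne_st; apply: invg_inj; apply/permP => a.
  by apply/eqP/negPn/negP => ne; apply: eq_uv; exists a.
have [b] : exists b, b \notin [:: a; t (u a)] by apply: ord_avoid; rewrite /=; lia.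
rewrite !inE negb_or => /andP [ba bt].
(* the coefficients of (x_(u a) - x_(u b)) - (x_(v a) - x_(v b)) *)
pose alpha c : F := (c == u a)%:R - (c == u b)%:R - (c == v a)%:R + (c == v b)%:R.
have alpha_ua : alpha (u a) = 1.
  rewrite /alpha eqxx (inj_eq perm_inj) (eq_sym a) (negPf ba) (negPf ne_uv) !subr0.
  rewrite (_ : (_ == v b) = false) ?addr0 //; apply/eqP => E; case/eqP: bt.
  by rewrite E permKV.
have sum_delta (V : lmodType F) (x : 'I_n -> V) c : \sum_i (i == c)%:R *: x i = x c.
  rewrite (bigD1 c) //= eqxx scale1r big1 ?addr0 // => i /negPf ->.
  by rewrite scale0r.
have sum_alpha (V : lmodType F) (x : 'I_n -> V) :
    \sum_i alpha i *: x i = (x (u a) - x (u b)) - (x (v a) - x (v b)).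
  under eq_bigr => i _ do rewrite scalerDl !scalerBl.
  by rewrite big_split !sumrB !sum_delta /= opprB addrA addrAC.
have [||const d0] := root_kernel (alpha := alpha).
- have := sum_alpha F^o (fun=> 1); rewrite !subrr => E0.
  by rewrite -[RHS]E0; apply: eq_bigr => i _; rewrite /GRing.scale /= mulr1.
- by rewrite sum_alpha -!root_act same subrr.
have last1 : alpha ord_max = 1 by rewrite -alpha_ua const.
case: m_d => [m_gt2|d1]; last first.
  by move/eqP: d0; rewrite d1 last1 mulr1 oner_eq0.
have [c] : exists c, c \notin [:: u a; u b; v a; v b] by apply: ord_avoid; rewrite /=; lia.
rewrite !inE !negb_or => /and4P [c1 c2 c3 c4].
have := const c; rewrite last1 /alpha (negPf c1) (negPf c2) (negPf c3) (negPf c4).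
by rewrite !subr0 addr0 => /eqP; rewrite eq_sym oner_eq0.
Qed.

End Field.
Lemma invariant_linear_part (f : {mpoly rat[m.+1]}) j : (0 < m)%N ->
  f \in invariant_pred L -> f@_U_(j) = 0.
Proof.
move=> m_gt0 f_inv.
have e_neq0 : e%:R != 0 :> rat by rewrite pnatr_eq0; apply/eqP; lia.
have [h <-] := craig_basic_surj (mulVf e_neq0)
  (iota := idfun : {rmorphism rat -> rat}) (fun _ _ E => E) d_gt0 nE craigL m_gt0 f_inv.
apply: mcoeffU_comp => k; apply: mcoeffU_elemsym => a.
exact: lform_coef0.
Qed.

Lemma not_polynomial (R : comNzRingType) (iota : {rmorphism R -> rat}) (p : nat) :
    injective iota -> (0 < m)%N -> (2 < m)%N \/ d = 1%N ->
    prime p -> (p %| e)%N -> ~ (exists r : R, r * p%:R = 1) ->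
  ~ is_polynomial_ring (invariants R L).
Proof.
move=> inj_iota m_gt0 m_d p_pr p_e p_ninv poly.
have [red [red_surj red_p red_ker]] := reduction_mod_p inj_iota p_pr p_ninv.
have e0 : e%:R = 0 :> 'F_p by apply/eqP; rewrite -(dvdn_pcharf (pchar_Fp p_pr)).
have X0_inv s : map_mpoly red (poly_act L s 'X_0) = map_mpoly red 'X_0.
  by rewrite map_poly_act map_mpolyX X0_act.
have [f f_inv fX0] := lift_invariant red_surj red_p red_ker
  (prime_regular inj_iota p_pr) (act_faithful e0 m_gt0 m_d) X0_inv poly.
have f_lin : f@_U_(0) = 0.
  apply: inj_iota; rewrite rmorph0 -mcoeff_map_mpoly; apply: invariant_linear_part => //.
  by apply/invariantP => s; rewrite -map_poly_act (invariantP _ _ f_inv).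
exact: mcoeffU_lift_neq0 fX0 f_lin.
Qed.

End OnlyIf.

(** * The exceptional case n = 4, d = 2 *)

Lemma elemsymS (A : comNzRingType) n (x : 'I_n.+1 -> A) k :
  elemsym x k.+1 = elemsym (fun i => x (widen_ord (leqnSn n) i)) k.+1
    + elemsym (fun i => x (widen_ord (leqnSn n) i)) k * x ord_max.
Proof.
pose ev l (y : 'I_l -> A) : {rmorphism {mpoly int[l]} -> A} := mmap intr y.
have evE l (y : 'I_l -> A) j : ev l y (mesym l int j) = elemsym y j.
  rewrite (rmorph_elemsym (ev l y) (fun i => 'X_i)).
  by apply: eq_elemsym => i; rewrite /= mmapX mmap1U.
have evw j : ev _ x (mwiden (mesym n int j)) = elemsym (fun i => x (widen_ord (leqnSn n) i)) j.
  rewrite (rmorph_elemsym (@mwiden n int) (fun i => 'X_i)).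
  rewrite (rmorph_elemsym (ev _ x)).
  by apply: eq_elemsym => i; rewrite /= mwidenX mnmwiden1 mmapX mmap1U.
by rewrite -evE mesymSS rmorphD rmorphM !evw /= mmapX mmap1U.
Qed.

Lemma elemsym_gt (A : comNzRingType) n (x : 'I_n -> A) k : (n < k)%N -> elemsym x k = 0.
Proof.
move=> lt_nk; rewrite /elemsym big_pred0 // => h; apply/negbTE; rewrite neq_ltn.
by rewrite (leq_ltn_trans (max_card h)) // card_ord.
Qed.

Local Notation ord3 k := (@Ordinal 3 k isT).
Local Notation ord4 k := (@Ordinal 4 k isT).

Lemma elemsym3E (A : comNzRingType) (x : 'I_3 -> A)
    (a := x (ord3 0)) (b := x (ord3 1)) (c := x (ord3 2)) :
  [/\ elemsym x 1 = a + b + c, elemsym x 2 = a * b + a * c + b * c & elemsym x 3 = a * b * c].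
Proof.
pose w i := widen_ord (leqnSn i).
have -> : a = x (w 2 (w 1%N ord_max)) by congr x; apply: ord_inj.
have -> : b = x (w 2 ord_max) by congr x; apply: ord_inj.
have -> : c = x ord_max by congr x; apply: ord_inj.
by split; rewrite !elemsymS !elemsym0 !elemsym_gt // /w; ring.
Qed.

Lemma elemsym4E (A : comNzRingType) (x : 'I_4 -> A)
    (a := x (ord4 0)) (b := x (ord4 1)) (c := x (ord4 2)) (d := x (ord4 3)) :
  [/\ elemsym x 2 = a * b + a * c + a * d + b * c + b * d + c * d,
      elemsym x 3 = a * b * c + a * b * d + a * c * d + b * c * d
    & elemsym x 4 = a * b * c * d].
Proof.
pose w i := widen_ord (leqnSn i).
have -> : a = x (w 3 (w 2 (w 1%N ord_max))) by congr x; apply: ord_inj.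
have -> : b = x (w 3 (w 2 ord_max)) by congr x; apply: ord_inj.
have -> : c = x (w 3 ord_max) by congr x; apply: ord_inj.
have -> : d = x ord_max by congr x; apply: ord_inj.
by split; rewrite !elemsymS !elemsym0 !elemsym_gt // /w; ring.
Qed.

Lemma sum4E (V : zmodType) (x : 'I_4 -> V) :
  \sum_i x i = x (ord4 0) + x (ord4 1) + x (ord4 2) + x (ord4 3).
Proof.
rewrite !big_ord_recr big_ord0 /= add0r.
by congr (x _ + x _ + x _ + x _); apply: ord_inj.
Qed.

Lemma cube_span_add (A : comNzRingType) (p q r a b c d a' b' c' d' : A) :
  (a + b * p + c * q + d * r) + (a' + b' * p + c' * q + d' * r)
  = (a + a') + (b + b') * p + (c + c') * q + (d + d') * r.
Proof. by ring. Qed.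

(** The span of 1, p1, p2, p1 p2 over the ring generated by s1, s2, t is closed under
    products, because p1^2 = s1 + 2 p2 and p2^2 = s2 + 2 t p1. *)
Lemma cube_span_mul (A : comNzRingType) (u v w a b c d a' b' c' d' : A)
    (t := u * v * w) (p1 := u + v + w) (p2 := u * v + u * w + v * w)
    (s1 := u ^+ 2 + v ^+ 2 + w ^+ 2)
    (s2 := (u * v) ^+ 2 + (u * w) ^+ 2 + (v * w) ^+ 2) :
  (a + b * p1 + c * p2 + d * (p1 * p2)) * (a' + b' * p1 + c' * p2 + d' * (p1 * p2))
  = (a * a' + b * b' * s1 + c * c' * s2 + (b * d' + d * b') * s2 *+ 2
     + (c * d' + d * c') * t * s1 *+ 2 + d * d' * s1 * s2)
  + (a * b' + b * a' + c * c' * t *+ 2 + (b * d' + d * b') * t *+ 4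
     + (c * d' + d * c') * s2 + d * d' * t * s1 *+ 2) * p1
  + (a * c' + c * a' + b * b' *+ 2 + (b * d' + d * b') * s1
     + (c * d' + d * c') * t *+ 4 + d * d' * s2 *+ 2) * p2
  + (a * d' + d * a' + b * c' + c * b' + d * d' * t *+ 4) * (p1 * p2).
Proof. rewrite /t /p1 /p2 /s1 /s2; ring. Qed.

(** Averaging over the even sign changes kills the first two elementary symmetric
    expressions p1 and p2 and turns p1 p2 into 3 u v w. *)
Lemma sign_average (A : comNzRingType) (x : 'I_3 -> A) (a b c d f : A)
    (phi : 'I_3 -> {rmorphism A -> A}) (u := x (ord3 0)) (v := x (ord3 1)) (w := x (ord3 2)) :
  (forall i, [/\ phi i a = a, phi i b = b, phi i c = c, phi i d = d & phi i f = f]) ->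
  (forall i l, phi i (x l) = if l == i then x l else - x l) ->
  f = a + b * (u + v + w) + c * (u * v + u * w + v * w)
      + d * ((u + v + w) * (u * v + u * w + v * w)) ->
  4%:R * f = 4%:R * (a + 3%:R * (u * v * w) * d).
Proof.
move=> fix_phi sign_phi fE.
have image i : f = a + b * (phi i u + phi i v + phi i w)
    + c * (phi i u * phi i v + phi i u * phi i w + phi i v * phi i w)
    + d * ((phi i u + phi i v + phi i w)
           * (phi i u * phi i v + phi i u * phi i w + phi i v * phi i w)).
  by have [Ea Eb Ec Ed <-] := fix_phi i; rewrite {1}fE !(rmorphD, rmorphM) /= Ea Eb Ec Ed.
transitivity (f + f + f + f); first by ring.
rewrite {1}fE {1}(image (ord3 0)) {1}(image (ord3 1)) (image (ord3 2)).
by rewrite /u /v /w !sign_phi /=; ring.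
Qed.

(** The resolvent identities: for a + b + c + d = 0, the three invariants in the sums of
    pairs are -2 e_2, e_3 and e_2^2 - 4 e_4. *)
Lemma pair_sums_elemsym (A : comNzRingType) (a b c d : A) : d = - (a + b + c) ->
  [/\ (a + b) ^+ 2 + (a + c) ^+ 2 + (a + d) ^+ 2
        = - 2%:R * (a * b + a * c + a * d + b * c + b * d + c * d),
      (a + b) * (a + c) * (a + d) = a * b * c + a * b * d + a * c * d + b * c * d
    & ((a + b) * (a + c)) ^+ 2 + ((a + b) * (a + d)) ^+ 2 + ((a + c) * (a + d)) ^+ 2
        = (a * b + a * c + a * d + b * c + b * d + c * d) ^+ 2 - 4%:R * (a * b * c * d)].
Proof. by move=> ->; split; ring. Qed.

Section FourTwo.

Variable L : mx_representation int [set: 'S_4] 3.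
Hypothesis craigL : is_craig_rep 2 L.

(** The rows are the forms u, v, w, halves of sums of two rows of [coord_mx]. *)
Definition cube_mx : 'M[int]_3 := \matrix_(i, j)
  nth 0 (nth [::] [:: [:: 1; 2; 1]; [:: 1; 1; 1]; [:: -1; -1; 0]] i) j.

Definition cube_inv : 'M[int]_3 := \matrix_(i, j)
  nth 0 (nth [::] [:: [:: -1; 1; -1]; [:: 1; -1; 0]; [:: 0; 1; 1]] i) j.

Lemma cube_mxE i j : 2%:Z * cube_mx i j = coord_mx 2 2 ord0 j + coord_mx 2 2 (lift ord0 i) j.
Proof.
rewrite !mxE /coord_entry -(inj_eq val_inj).
by case: i => [[|[|[|i]]] Hi] //; case: j => [[|[|[|j]]] Hj].
Qed.

Lemma cube_invK : cube_inv *m cube_mx = 1%:M.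
Proof.
apply/matrixP => i j; rewrite !mxE !big_ord_recl big_ord0 !mxE -(inj_eq val_inj) /=.
by case: i => [[|[|[|i]]] Hi] //; case: j => [[|[|[|j]]] Hj].
Qed.

Section Forms.

Variable R : comNzRingType.

Definition cube_coord (i : 'I_3) : {mpoly R[3]} := lform (map_mx intr cube_mx) i.

Local Notation Z a := (lform (map_mx intr (coord_mx 2 2)) a : {mpoly R[3]}).

Lemma coord_cube i : Z ord0 + Z (lift ord0 i) = 2%:R * cube_coord i.
Proof.
rewrite -(mpolyC_nat _ _ 2) mul_mpolyC -big_split scaler_sumr; apply: eq_bigr => j _.
by rewrite /= -scalerDl scalerA !(mxE map_mx_key) -rmorphD -cube_mxE rmorphM.
Qed.

Lemma coord_sum0 : \sum_a Z a = 0.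
Proof.
rewrite exchange_big big1 // => j _; rewrite -scaler_suml.
under eq_bigr => a _ do rewrite (mxE map_mx_key).
by rewrite -rmorph_sum /= coord_mx_sum scale0r.
Qed.

Lemma cube_act s i :
  2%:R * poly_act L s (cube_coord i) = Z (s^-1%g ord0) + Z (s^-1%g (lift ord0 i)).
Proof.
have act a : poly_act L s (Z a) = Z (s^-1%g a).
  rewrite poly_act_lform (@coord_mx_act 2 2 2 _ _ _ craigL) //.
  by apply: eq_bigr => j _; rewrite !(mxE map_mx_key) (mxE row_perm_key).
by rewrite -!act -rmorphD /= coord_cube rmorphM rmorph_nat.
Qed.

Let u := cube_coord (ord3 0).
Let v := cube_coord (ord3 1).
Let w := cube_coord (ord3 2).

Definition cube_gen (k : 'I_3) : {mpoly R[3]} :=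
  nth 0 [:: u ^+ 2 + v ^+ 2 + w ^+ 2; u * v * w;
            (u * v) ^+ 2 + (u * w) ^+ 2 + (v * w) ^+ 2] k.

Definition cube_invariant : {mpoly R[3]} -> {mpoly R[3]} :=
  comp_mpoly [tuple cube_gen k | k < 3].

HB.instance Definition _ := GRing.RMorphism.copy cube_invariant
  (comp_mpoly [tuple cube_gen k | k < 3]).
HB.instance Definition _ := GRing.Linear.copy cube_invariant
  (comp_mpoly [tuple cube_gen k | k < 3]).

Lemma cube_invariantX k : cube_invariant 'X_k = cube_gen k.
Proof. exact: comp_mpolyU. Qed.

Lemma cube_coordK f :
  (f \mPo [tuple lform (map_mx intr cube_inv) i | i < 3])
    \mPo [tuple cube_coord i | i < 3] = f.
Proof.
rewrite comp_mpoly_comp -[RHS]comp_mpoly_id; apply: eq_comp_mpoly => i.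
by rewrite lform_comp -map_mxM cube_invK map_mx1 lform1.
Qed.

Lemma cube_coordVK f :
  (f \mPo [tuple cube_coord i | i < 3])
    \mPo [tuple lform (map_mx intr cube_inv) i | i < 3] = f.
Proof.
rewrite comp_mpoly_comp -[RHS]comp_mpoly_id; apply: eq_comp_mpoly => i.
by rewrite lform_comp -map_mxM (mulmx1C cube_invK) map_mx1 lform1.
Qed.

Lemma cube_coord_inj : injective (comp_mpoly [tuple cube_coord i | i < 3]).
Proof. exact: (can_inj (g := comp_mpoly _) cube_coordVK). Qed.

Lemma cube_span F : exists a b c d, F \mPo [tuple elemsym cube_coord k.+1 | k < 3]
  = cube_invariant a + cube_invariant b * elemsym cube_coord 1
    + cube_invariant c * elemsym cube_coord 2
    + cube_invariant d * (elemsym cube_coord 1 * elemsym cube_coord 2).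
Proof.
have [E1 E2 E3] := elemsym3E cube_coord.
pose s1 : {mpoly R[3]} := 'X_(ord3 0); pose t : {mpoly R[3]} := 'X_(ord3 1).
pose s2 : {mpoly R[3]} := 'X_(ord3 2).
have s1E : cube_invariant s1 = u ^+ 2 + v ^+ 2 + w ^+ 2 by rewrite cube_invariantX.
have tE : cube_invariant t = u * v * w by rewrite cube_invariantX.
have s2E : cube_invariant s2 = (u * v) ^+ 2 + (u * w) ^+ 2 + (v * w) ^+ 2.
  by rewrite cube_invariantX.
elim/mpoly_ring_ind: F => [k|i|p q [a [b [c [d Ep]]]] [a' [b' [c' [d' Eq]]]]
                              |p q [a [b [c [d Ep]]]] [a' [b' [c' [d' Eq]]]]].
- exists k%:MP, 0, 0, 0; rewrite !rmorph0 !mul0r !addr0 comp_mpolyC.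
  by rewrite [cube_invariant _]comp_mpolyC.
- rewrite comp_mpolyU; case: i => [[|[|[|i]]] Hi] //=.
  + by exists 0, 1, 0, 0; rewrite !rmorph0 rmorph1 !mul0r !addr0 add0r mul1r.
  + by exists 0, 0, 1, 0; rewrite !rmorph0 rmorph1 !mul0r !addr0 !add0r mul1r.
  by exists t, 0, 0, 0; rewrite !rmorph0 !mul0r !addr0 tE E3.
- exists (a + a'), (b + b'), (c + c'), (d + d').
  by rewrite !rmorphD /= Ep Eq; apply: cube_span_add.
exists (a * a' + b * b' * s1 + c * c' * s2 + (b * d' + d * b') * s2 *+ 2
        + (c * d' + d * c') * t * s1 *+ 2 + d * d' * s1 * s2),
  (a * b' + b * a' + c * c' * t *+ 2 + (b * d' + d * b') * t *+ 4
        + (c * d' + d * c') * s2 + d * d' * t * s1 *+ 2),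
  (a * c' + c * a' + b * b' *+ 2 + (b * d' + d * b') * s1
        + (c * d' + d * c') * t *+ 4 + d * d' * s2 *+ 2),
  (a * d' + d * a' + b * c' + c * b' + d * d' * t *+ 4).
have -> : (p * q) \mPo [tuple elemsym cube_coord k.+1 | k < 3]
    = (p \mPo [tuple elemsym cube_coord k.+1 | k < 3])
      * (q \mPo [tuple elemsym cube_coord k.+1 | k < 3]) by rewrite rmorphM.
rewrite Ep Eq !(rmorphD, rmorphMn, rmorphM) /=.
by rewrite s1E s2E tE E1 E2; apply: cube_span_mul.
Qed.

End Forms.

Variables (R K : comNzRingType) (j : {rmorphism R -> K}) (iota : {rmorphism K -> rat}).
Hypotheses (inj_j : injective j) (inj_iota : injective iota).
Variable half : K.
Hypothesis halfE : half * 2%:R = 1.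

Lemma mpoly_nat_inj k c : (0 < c)%N -> injective ( *%R c%:R : {mpoly R[k]} -> {mpoly R[k]}).
Proof.
move=> c_gt0 p q E; apply/mpolyP => l; apply: inj_j; apply: inj_iota.
have c_neq0 : c%:R != 0 :> rat by rewrite pnatr_eq0 -lt0n.
have coefE (f : {mpoly R[k]}) : (c%:R * f)@_l = c%:R * f@_l.
  by rewrite -mpolyC_nat mul_mpolyC mcoeffZ.
apply: (mulfI c_neq0); rewrite -(rmorph_nat iota) -!rmorphM -(rmorph_nat j) -!rmorphM.
by rewrite -!coefE E.
Qed.

Local Notation cube := (cube_coord R).
Local Notation Z a := (lform (map_mx intr (coord_mx 2 2)) a : {mpoly R[3]}).

Lemma cube_perm (s : 'S_3) : exists g, forall i, poly_act L g (cube i) = cube (s i).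
Proof.
exists (lift_perm ord0 ord0 s)^-1%g => i; apply: (@mpoly_nat_inj 3 2 isT).
by rewrite cube_act invgK lift_perm_id lift_perm_lift coord_cube.
Qed.

(** The double transposition that exchanges 0 and i + 1 fixes x_0 + x_(i+1), and it
    replaces each of the two other sums by the complementary sum, its opposite. *)
Lemma cube_sign (i : 'I_3) : exists g, forall l,
  poly_act L g (cube l) = if l == i then cube l else - cube l.
Proof.
pose f (a : 'I_4) : 'I_4 := nth ord0 (nth [::]
  [:: [:: ord4 1; ord4 0; ord4 3; ord4 2]; [:: ord4 2; ord4 3; ord4 0; ord4 1];
      [:: ord4 3; ord4 2; ord4 1; ord4 0]] i) a.
have fK : cancel f f.
  rewrite /f; case: i {f} => [[|[|[|i]]] Hi] // [[|[|[|[|a]]]] Ha] //; exact: ord_inj.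
exists (perm (can_inj fK))^-1%g => l; apply: (@mpoly_nat_inj 3 2 isT).
rewrite cube_act invgK !permE.
have sumZ : Z (ord4 0) + Z (ord4 1) + Z (ord4 2) + Z (ord4 3) = 0.
  by rewrite -(coord_sum0 R) sum4E.
have cubeE k : 2%:R * cube k = Z (ord4 0) + Z (lift ord0 k).
  by rewrite -coord_cube; congr (lform _ _ + _); apply: ord_inj.
have l0 (H : (0 < 3)%N) : lift ord0 (Ordinal H) = ord4 1 by apply: ord_inj.
have l1 (H : (1 < 3)%N) : lift ord0 (Ordinal H) = ord4 2 by apply: ord_inj.
have l2 (H : (2 < 3)%N) : lift ord0 (Ordinal H) = ord4 3 by apply: ord_inj.
have Z3 : Z (ord4 3) = - (Z (ord4 0) + Z (ord4 1) + Z (ord4 2)).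
  by apply/eqP; rewrite -addr_eq0 addrC sumZ.
rewrite -(inj_eq val_inj) {fK} /f.
case: l => [[|[|[|l]]] Hl] //; rewrite ?l0 ?l1 ?l2; case: i => [[|[|[|i]]] Hi] //=;
  rewrite ?mulrN cubeE ?l0 ?l1 ?l2 ?Z3; ring.
Qed.

Local Notation x := (@craig_coord 2 2 K half).

(** Once 2 is invertible, the generators are an invertible polynomial substitution in
    e_2, e_3, e_4; so their invariance and their independence follow from the case where
    n / d is invertible. *)
Lemma cube_invariant_basic h : cube_invariant h = basic_invariant x
  (h \mPo [tuple nth 0 [:: - 2%:R * 'X_(ord3 0); 'X_(ord3 1);
                            'X_(ord3 0) ^+ 2 - 4%:R * 'X_(ord3 2)] k | k < 3]).
Proof.
rewrite /basic_invariant comp_mpoly_comp; apply: eq_comp_mpoly => k.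
have cubex l i : l = lift ord0 i -> cube_coord K i = x (ord4 0) + x l.
  move=> ->; rewrite /craig_coord !lformZ -scalerDr.
  have -> : ord4 0 = ord0 by apply: ord_inj.
  by rewrite coord_cube -(mpolyC_nat _ _ 2) mul_mpolyC scalerA halfE scale1r.
have x3 : x (ord4 3) = - (x (ord4 0) + x (ord4 1) + x (ord4 2)).
  by apply/eqP; rewrite -addr_eq0 addrC -sum4E craig_coord_sum.
have [e2 e3 e4] := elemsym4E x.
have c0 : cube_coord K (ord3 0) = x (ord4 0) + x (ord4 1) by apply: cubex; apply: ord_inj.
have c1 : cube_coord K (ord3 1) = x (ord4 0) + x (ord4 2) by apply: cubex; apply: ord_inj.
have c2 : cube_coord K (ord3 2) = x (ord4 0) + x (ord4 3) by apply: cubex; apply: ord_inj.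
have [s1E tE s2E] := pair_sums_elemsym x3.
case: k => [[|[|[|k]]] Hk] //; rewrite /cube_gen /= c0 c1 c2.
- by rewrite rmorphM rmorphN rmorph_nat /= comp_mpolyU e2 s1E.
- by rewrite comp_mpolyU e3 tE.
by rewrite rmorphB rmorphXn rmorphM rmorph_nat /= !comp_mpolyU e2 e4 s2E.
Qed.

Lemma cube_invariant_inj_half : injective (@cube_invariant K).
Proof.
move=> h h'; rewrite !cube_invariant_basic => E.
have {E} := craig_basic_inj halfE inj_iota E.
pose hC : {mpoly K[3]} := half%:MP.
have hCE : hC * 2%:R = 1 by rewrite -mpolyC_nat -mpolyCM halfE.
(* the inverse substitution: e_2 = - s1 / 2 and e_4 = (s1^2 / 4 - s2) / 4 *)
pose back := [tuple nth 0 [:: - hC * 'X_(ord3 0); 'X_(ord3 1);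
    hC ^+ 4 * 'X_(ord3 0) ^+ 2 - hC ^+ 2 * 'X_(ord3 2)] k | k < 3].
move/(congr1 (comp_mpoly back)); rewrite !comp_mpoly_comp => E.
suff idE (g : {mpoly K[3]}) : g = g \mPo [tuple (nth 0 [:: - 2%:R * 'X_(ord3 0); 'X_(ord3 1);
      'X_(ord3 0) ^+ 2 - 4%:R * 'X_(ord3 2)] k) \mPo back | k < 3].
  exact: etrans (idE h) (etrans E (esym (idE h'))).
rewrite -[LHS]comp_mpoly_id; apply: eq_comp_mpoly => k.
have ordE (i l : 'I_3) : l = i :> nat -> 'X_i = 'X_l :> {mpoly K[3]}.
  by move=> li; congr mpolyX; congr mnm1; apply: ord_inj.
case: k => [[|[|[|k]]] Hk]; last by [].
- rewrite /= rmorphM rmorphN rmorph_nat /= comp_mpolyU /= (ordE _ (ord3 0)) //.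
  by rewrite mulrA mulrNN mulrC -(mulrC hC) hCE mulr1.
- by rewrite /= comp_mpolyU /= (ordE _ (ord3 1)).
rewrite /= rmorphB rmorphXn rmorphM rmorph_nat /= !comp_mpolyU /= (ordE _ (ord3 2)) //.
move: hCE {back E}.
move: hC ('X_(ord3 0) : {mpoly K[3]}) ('X_(ord3 2) : {mpoly K[3]}) => c X Y cE.
transitivity (c ^+ 2 * X ^+ 2 * (1 - (c * 2%:R) ^+ 2) + (c * 2%:R) ^+ 2 * Y).
  by rewrite cE expr1n subrr mulr0 add0r mul1r.
by ring.
Qed.

Lemma cube_invariant_act_half s h :
  poly_act L s (cube_invariant h) = cube_invariant h :> {mpoly K[3]}.
Proof.
rewrite cube_invariant_basic; apply: (invariantP _ _ _ s).
exact: (@craig_basic_inv 2 2 K _ 2 isT erefl L craigL).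
Qed.

Lemma cube_invariant_map h :
  map_mpoly j (cube_invariant h : {mpoly R[3]})
    = cube_invariant (map_mpoly j h) :> {mpoly K[3]}.
Proof.
rewrite /cube_invariant map_comp_mpoly; apply: eq_comp_mpoly => k.
have cube_map i : map_mpoly j (cube i) = cube_coord K i.
  rewrite rmorph_sum; apply: eq_bigr => l _.
  by rewrite /= map_mpolyZ map_mpolyX !(mxE map_mx_key) rmorph_int.
by case: k => [[|[|[|k]]] Hk] //;
  rewrite /cube_gen /= !(rmorphD, rmorphXn, rmorphM) /= !cube_map.
Qed.

Lemma cube_invariant_inj : injective (@cube_invariant R).
Proof.
move=> h h' /(congr1 (map_mpoly j)); rewrite !cube_invariant_map.
by move/cube_invariant_inj_half/(map_mpoly_inj inj_j).
Qed.

Lemma cube_invariant_act s h :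
  poly_act L s (cube_invariant h) = cube_invariant h :> {mpoly R[3]}.
Proof.
apply: (map_mpoly_inj inj_j).
by rewrite map_poly_act !cube_invariant_map cube_invariant_act_half.
Qed.

(** An invariant is a symmetric polynomial in u, v, w, so it lies in the span of
    [cube_span]; averaging over the sign changes leaves a polynomial in the generators,
    up to the factor 4, which can be cancelled. *)
Lemma cube_surj (f : {mpoly R[3]}) : f \in invariant_pred L -> exists h, cube_invariant h = f.
Proof.
move=> /invariantP f_inv.
pose F := f \mPo [tuple lform (map_mx intr cube_inv) i | i < 3].
have fF : f = F \mPo [tuple cube i | i < 3] by rewrite cube_coordK.
have actF s G : poly_act L s (G \mPo [tuple cube i | i < 3])
    = G \mPo [tuple poly_act L s (cube i) | i < 3].
  elim/mpoly_ring_ind: G => [c|i|p q IHp IHq|p q IHp IHq].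
  - by rewrite !comp_mpolyC poly_actC.
  - by rewrite !comp_mpolyU.
  - by rewrite !rmorphD /= IHp IHq.
  - by rewrite !rmorphM /= IHp IHq.
have symF : F \is symmetric.
  apply/issymP => s; have [g gE] := cube_perm s.
  apply: cube_coord_inj.
  rewrite msym_mPo -fF -[RHS](f_inv g) fF actF; apply: eq_comp_mpoly => i.
  by rewrite tnth_mktuple gE.
have [H [HF _]] := sym_fundamental symF.
have [a [b [c [d fE]]]] := cube_span H.
have {}fE : f = cube_invariant a + cube_invariant b * elemsym cube 1
    + cube_invariant c * elemsym cube 2 + cube_invariant d * (elemsym cube 1 * elemsym cube 2).
  rewrite -fE fF -HF comp_mpoly_comp; apply: eq_comp_mpoly => i.
  by rewrite comp_mesym.
have [E1 E2 _] := elemsym3E cube; rewrite {}E1 {}E2 in fE.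
exists (a + 3%:R * 'X_(ord3 1) * d).
rewrite rmorphD !rmorphM rmorph_nat /= [X in _ * X * _]cube_invariantX /cube_gen [nth _ _ _]/=.
have [g0 E0] := cube_sign (ord3 0).
have [g1 E1] := cube_sign (ord3 1).
have [g2 E2] := cube_sign (ord3 2).
pose g (i : 'I_3) := nth 1%g [:: g0; g1; g2] i.
apply: (@mpoly_nat_inj 3 4 isT); apply/esym.
apply: (sign_average (phi := fun i => poly_act L (g i))) fE => i.
  by split; [exact: cube_invariant_act..|exact: f_inv].
by case: i => [[|[|[|i]]] Hi] l; [exact: E0|exact: E1|exact: E2|].
Qed.

Lemma cube_is_polynomial : is_polynomial_ring (invariants R L).
Proof.
apply: (is_polynomial_ring_by (psi := @cube_invariant R)).
- by move=> h; apply/invariantP => s; apply: cube_invariant_act.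
- exact: cube_invariant_inj.
exact: cube_surj.
Qed.

End FourTwo.

(** * The theorem *)

Lemma inverse_of_primes (R : comNzRingType) k : (0 < k)%N ->
  (forall p, prime p -> (p %| k)%N -> exists r : R, r * p%:R = 1) ->
  exists r : R, r * k%:R = 1.
Proof.
elim/ltn_ind: k => k IH k_gt0 inv_p.
have [k_gt1|] := ltnP 1 k; last first.
  by case: k k_gt0 {IH inv_p} => [|[|k]] // _ _; exists 1; rewrite mulr1.
have p_pr := pdiv_prime k_gt1; have p_dvd := pdiv_dvd k.
have [r rp] := inv_p _ p_pr p_dvd.
have [||q p_pr' q_dvd|r' rk] := IH (k %/ pdiv k)%N.
- by rewrite ltn_Pdiv ?prime_gt1.
- by rewrite divn_gt0 ?prime_gt0 // dvdn_leq.
- by apply: inv_p => //; apply: dvdn_trans q_dvd (dvdn_div p_dvd).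
exists (r' * r); rewrite -{1}(divnK p_dvd) natrM.
transitivity ((r' * (k %/ pdiv k)%:R) * (r * (pdiv k)%:R)); first by ring.
by rewrite rk rp mulr1.
Qed.

Theorem theorem2p6 (n d : nat) (n_ge3 : (3 <= n)%N) (d_gt0 : (0 < d)%N)
    (d_dvd_n : (d %| n)%N)
    (L : mx_representation int [set: 'S_n] n.-1) (craigL : is_craig_rep d L) :
  ((n, d) <> (4, 2)%N ->
     forall (R : comNzRingType) (iota : {rmorphism R -> rat}),
       injective iota ->
       is_polynomial_ring (invariants R L)
         <-> exists r : R, iota r = d%:R / n%:R)
  /\ ((n, d) = (4, 2)%N ->
        is_polynomial_ring (invariants int L)
        /\ ~ exists r : int, r%:~R = d%:R / n%:R :> rat).
Proof.
case: n n_ge3 d_dvd_n L craigL => [//|[//|m]] n_ge3 /dvdnP [e nE] L craigL.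
have m_gt0 : (0 < m)%N by [].
split=> [not42 R iota inj_iota|[m2 d2]]; last first.
  move: m m2 nE {n_ge3 m_gt0} L craigL => _ -> _; rewrite {}d2 => L craigL.
  split.
    exact: (cube_is_polynomial craigL (j := intr : {rmorphism int -> rat})
      (iota := idfun : {rmorphism rat -> rat}) (@intr_inj rat) (fun _ _ E => E)
      (mulVf (isT : 2%:R != 0 :> rat))).
  case=> r /(congr1 ( *%R^~ 2%:R)).
  have -> : 2%:R / 4%:R * 2%:R = 1%:~R :> rat by [].
  rewrite -[X in _ * X = _](rmorph_nat (intr : {rmorphism int -> rat})) -rmorphM.
  by move/(@intr_inj rat) => E; lia.
have e_neq0 : e%:R != 0 :> rat by rewrite pnatr_eq0; apply/eqP; lia.
have d_neq0 : d%:R != 0 :> rat by rewrite pnatr_eq0 -lt0n.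
have iotaE (r : R) : iota r = d%:R / m.+2%:R <-> r * e%:R = 1.
  rewrite nE natrM; split=> [E|E].
    apply: inj_iota; rewrite rmorphM E rmorph_nat rmorph1; field.
    by rewrite e_neq0 d_neq0.
  have /(congr1 iota) := E; rewrite rmorphM rmorph_nat rmorph1 => {}E.
  by apply: (mulIf e_neq0); rewrite E; field; rewrite e_neq0 d_neq0.
split=> [poly|[r /iotaE r_inv]]; last first.
  exact: (craig_is_polynomial r_inv inj_iota d_gt0 nE craigL m_gt0).
suff [r r_inv] : exists r : R, r * e%:R = 1 by exists r; apply/iotaE.
apply: inverse_of_primes => [|p p_pr p_dvd]; first by lia.
apply: NNPP => p_ninv.
(* for n <= 4 and e > 1, only d = 1 and the excluded (n, d) = (4, 2) are left *)
have m_d : (2 < m)%N \/ d = 1%N.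
  have e_gt1 : (1 < e)%N by apply: leq_trans (prime_gt1 p_pr) (dvdn_leq _ p_dvd); lia.
  case: (leqP m 2) => [m_le2|]; [right|by left].
  have [d1|d2] : (d <= 1)%N \/ (2 <= d)%N by lia.
    by lia.
  case: not42; have ed : (2 * 2 <= e * d)%N by apply: leq_mul.
  have m2 : m = 2%N by lia.
  have d4 : d = 2%N by nia.
  by rewrite m2 d4.
exact: (not_polynomial d_gt0 nE craigL inj_iota m_gt0 m_d p_pr p_dvd p_ninv).
Qed.
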